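(* Let $A$ be a Noetherian $k$-algebra which is either semiperfect and basic, or positively graded, let $e$ be a nonzero idempotent of $A$ (of degree $0$ if $A$ is positively graded), let $\Gamma=(1-e)A(1-e)$ and $S_e=eA/e\,\mathrm{rad}A$. Suppose that $\mathrm{Ext}_A^i(S_e,S_e)=0$ for all $i>0$. Then the global dimension of $A$ is finite if and only if the global dimension of $\Gamma$ is finite. More precisely, we have the bounds $$\mathrm{gl.dim}\,\Gamma \le \max(\mathrm{id}_A S_e+\mathrm{pd}_A S_e-1,\ \mathrm{gl.dim}\,A)$$ and $$\mathrm{gl.dim}\,A\le 2\,\mathrm{gl.dim}\,\Gamma+2.$$
   Context: $k$ is an algebraically closed field. Algebras are associative and unital; Noetherian means left and right Noetherian. Semiperfect: with $\mathrm{rad}A$ the Jacobson radical, $A/\mathrm{rad}A$ is semisimple and idempotents lift modulo $\mathrm{rad}A$; basic: $A/\mathrm{rad}A$ is a finite product of division algebras. Positively graded: $A=\bigoplus_{i\ge 0}A_i$ as vector spaces, where $A_0$ is a product of finitely many copies of $k$ and $A_iA_j=A_{i+j}$ for all $i,j\ge 0$; in this case $\mathrm{rad}A$ denotes the graded Jacobson radical $\bigoplus_{i\ge1}A_i$. Of degree $0$ means lying in $A_0$. $\mathrm{Ext}_A$, $\mathrm{pd}_A$ (projective dimension) and $\mathrm{id}_A$ (injective dimension) refer to right $A$-modules (ungraded). $\mathrm{gl.dim}$ is the global dimension (left and right agree for Noetherian algebras). The zero module and the zero ring are regarded as having projective, respectively global, dimension $0$. *)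

(* Defs.v *)
From HB Require Import structures.
From mathcomp Require Import all_boot all_order all_algebra.
From mathcomp Require Import boolp constructive_ereal.

Set Implicit Arguments.
Unset Strict Implicit.
Unset Printing Implicit Defensive.

Import Order.TTheory GRing.Theory Num.Theory.
Local Open Scope ring_scope.
Local Open Scope quotient_scope.

(* Modules over R are left modules [lmodType R], as in the library; a right
   module over A is a left module over the converse ring A^c. In particular
   (A^c)^o is A as a right module over itself, with a *: x = x * a, and its
   submodules are the right ideals of A. *)

Section Submodules.
Variables (R : pzRingType) (M : lmodType R) (N : submodClosed M).

Definition submod : Type := {x : M | x \in N}.
HB.instance Definition _ := SubChoice.on submod.
HB.instance Definition _ := [SubChoice_isSubLmodule of submod by <:].

(* [submodClosed] does not inherit from [zmodClosed], which the library's
   quotient requires. *)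
Definition zmod_of_submod : {pred M} := fun x => x \in N.

Lemma zmod_of_submodP : zmod_closed zmod_of_submod.
Proof.
split=> [|x y]; first exact: rpred0.
move=> xN yN; have : x - y \in N by rewrite -scaleN1r rpredD ?rpredZ.
by [].
Qed.
HB.instance Definition _ :=
  GRing.isZmodClosed.Build M zmod_of_submod zmod_of_submodP.

Definition quomod : Type := Quotient.quot zmod_of_submod.
HB.instance Definition _ := GRing.Zmodule.on quomod.
HB.instance Definition _ := Quotient.on quomod.

Lemma pi_quomodP (x y : M) : \pi_quomod x = \pi_quomod y <-> x - y \in N.
Proof.
have -> : (x - y \in N) = (x - y \in zmod_of_submod) by [].
by rewrite Quotient.idealrBE; split=> /eqP.
Qed.

Lemma pi_quomodD (x y : M) :
  \pi_quomod (x + y) = \pi_quomod x + \pi_quomod y.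
Proof. exact: (raddfD (\pi_(Quotient.quot zmod_of_submod))). Qed.

Definition scale_quo (a : R) (u : quomod) : quomod := \pi_quomod (a *: repr u).

Lemma pi_quomodZ a (x : M) : \pi_quomod (a *: x) = scale_quo a (\pi_quomod x).
Proof.
by apply/pi_quomodP; rewrite -scalerBr rpredZ //; apply/pi_quomodP; rewrite reprK.
Qed.

Fact scale_quoA a b u : scale_quo a (scale_quo b u) = scale_quo (a * b) u.
Proof. by rewrite -[u]reprK -(pi_quomodZ b) -(pi_quomodZ a) -(pi_quomodZ (a * b)) scalerA. Qed.
Fact scale_quo1 : left_id 1 scale_quo.
Proof. by move=> u; rewrite -[u]reprK -(pi_quomodZ 1) scale1r. Qed.
Fact scale_quoDr : right_distributive scale_quo +%R.
Proof.
move=> a u v; rewrite -[u]reprK -[v]reprK.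
by rewrite -pi_quomodD -!(pi_quomodZ a) -pi_quomodD scalerDr.
Qed.
Fact scale_quoDl u : {morph scale_quo^~ u : a b / a + b}.
Proof.
move=> a b; rewrite -[u]reprK -(pi_quomodZ a) -(pi_quomodZ b).
by rewrite -(pi_quomodZ (a + b)) -pi_quomodD scalerDl.
Qed.
HB.instance Definition _ := GRing.Zmodule_isLmodule.Build R quomod
  scale_quoA scale_quo1 scale_quoDr scale_quoDl.

End Submodules.

Section SubQuotient.
Variables (R : pzRingType) (M : lmodType R) (N L : submodClosed M).

Definition submod_preim : {pred submod N} := fun x => val x \in L.

Lemma submod_preimP : submod_closed submod_preim.
Proof.
have memE x : (x \in submod_preim) = (val x \in L) by [].
split=> [|a x y]; rewrite !memE ?raddf0 ?rpred0 //= => xL yL.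
by rewrite rpredD ?rpredZ.
Qed.
HB.instance Definition _ :=
  GRing.isSubmodClosed.Build R (submod N) submod_preim submod_preimP.

(* N / (N \cap L), which is N / L when L is contained in N *)
Definition subquo := quomod submod_preim.
HB.instance Definition _ := GRing.Lmodule.on subquo.

End SubQuotient.

Section ModuleProperties.
Variables (R : pzRingType) (M : lmodType R).

Definition maximal_submod (N : submodClosed M) :=
  (exists x, x \notin N) /\
  forall L : submodClosed M, {subset N <= L} ->
    {subset L <= N} \/ forall x, x \in L.

Definition noetherian_mod :=
  forall N : nat -> submodClosed M, (forall i, {subset N i <= N i.+1}) ->
  exists n, forall m, (n <= m)%N -> {subset N m <= N n}.

Definition semisimple_mod :=
  forall N : submodClosed M, exists L : submodClosed M,
    (forall x, x \in N -> x \in L -> x = 0) /\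
    (forall x, exists y z, [/\ y \in N, z \in L & x = y + z]).

Definition projective :=
  forall (U V : lmodType R) (g : {linear U -> V}) (f : {linear M -> V}),
    (forall v, exists u, g u = v) ->
    exists h : {linear M -> U}, forall x, g (h x) = f x.

Definition injective_mod :=
  forall (U V : lmodType R) (g : {linear U -> V}) (f : {linear U -> M}),
    injective g ->
    exists h : {linear V -> M}, forall x, h (g x) = f x.

End ModuleProperties.

Section Resolutions.
Variables (R : pzRingType) (M : lmodType R).

(* ... -> P 1 -> P 0 -> M -> 0 *)
Record proj_resolution := ProjResolution {
  pr_obj :> nat -> lmodType R;
  pr_diff : forall i, {linear pr_obj i.+1 -> pr_obj i};
  pr_aug : {linear pr_obj 0 -> M};
  pr_projective : forall i, projective (pr_obj i);
  pr_aug_surj : forall x, exists y, pr_aug y = x;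
  pr_exact0 : forall x, pr_aug x = 0 <-> exists y, pr_diff 0 y = x;
  pr_exact : forall i x, pr_diff i x = 0 <-> exists y, pr_diff i.+1 y = x
}.

(* 0 -> M -> I 0 -> I 1 -> ... *)
Record inj_resolution := InjResolution {
  ir_obj :> nat -> lmodType R;
  ir_diff : forall i, {linear ir_obj i -> ir_obj i.+1};
  ir_aug : {linear M -> ir_obj 0};
  ir_injective : forall i, injective_mod (ir_obj i);
  ir_aug_inj : injective ir_aug;
  ir_exact0 : forall x, ir_diff 0 x = 0 <-> exists y, ir_aug y = x;
  ir_exact : forall i x, ir_diff i.+1 x = 0 <-> exists y, ir_diff i y = x
}.

Definition vanishes_above (X : nat -> lmodType R) (n : nat) :=
  forall i, (n < i)%N -> forall x : X i, x = 0.

Variable N : lmodType R.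

Definition cocycle (P : proj_resolution) i (f : {linear P i -> N}) :=
  forall x, f (pr_diff P i x) = 0.

Definition coboundary (P : proj_resolution) i : {linear P i -> N} -> Prop :=
  match i with
  | 0 => fun f => forall x, f x = 0
  | j.+1 => fun f =>
      exists g : {linear P j -> N}, forall x, f x = g (pr_diff P j x)
  end.

(* Ext^i(M, N) = 0, where Ext^i(M, N) is the i-th cohomology of Hom(P, N) for
   any projective resolution P of M. *)
Definition Ext_eq0 i :=
  forall (P : proj_resolution) (f : {linear P i -> N}),
    cocycle f -> coboundary f.

End Resolutions.

(* The least n satisfying P, +oo if there is none; values in \bar int so that
   the dimension formulas can be written literally. *)
Definition least (P : nat -> Prop) : \bar int :=
  match pselect (exists n, `[< P n >]) with
  | left exP => (Posz (ex_minn exP))%:E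
  | right _ => +oo%E
  end.

Definition pd (R : pzRingType) (M : lmodType R) : \bar int :=
  least (fun n => exists P : proj_resolution M, vanishes_above P n).

Definition inj_dim (R : pzRingType) (M : lmodType R) : \bar int :=
  least (fun n => exists I : inj_resolution M, vanishes_above I n).

Definition gldim (R : pzRingType) : \bar int :=
  least (fun n => forall M : lmodType R^c, (pd M <= (Posz n)%:E)%E).

Section Rings.
Variable A : nzRingType.

Definition noetherian :=
  noetherian_mod A^o /\ noetherian_mod (A^c)^o.

(* the intersection of the maximal right ideals *)
Definition jacobson : {pred (A^c)^o} :=
  fun x => `[< forall N : submodClosed (A^c)^o, maximal_submod N -> x \in N >].

Lemma jacobsonP : submod_closed jacobson.
Proof.
split=> [|a x y]; first by apply/asboolP => N _; exact: rpred0.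
move=> /asboolP xJ /asboolP yJ; apply/asboolP => N maxN.
by rewrite rpredD ?rpredZ ?xJ ?yJ.
Qed.
HB.instance Definition _ :=
  GRing.isSubmodClosed.Build A^c (A^c)^o jacobson jacobsonP.

Section Colon.
Variables (N : submodClosed (A^c)^o) (a : A).

Definition colon : {pred (A^c)^o} := fun x => (a * x : A) \in N.

Lemma colonP : submod_closed colon.
Proof.
split=> [|b x y].
  by change ((a * 0 : A) \in N); rewrite mulr0; exact: (@rpred0 _ N).
move=> xN yN; change ((a * ((x : A) * (b : A) + (y : A)) : A) \in N).
by rewrite mulrDr mulrA; exact: (rpredD (rpredZ b xN) yN).
Qed.
HB.instance Definition _ := GRing.isSubmodClosed.Build A^c (A^c)^o colon colonP.

End Colon.

Section AddCyclic.
Variables (N : submodClosed (A^c)^o) (a : A).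

Definition add_cyclic : {pred (A^c)^o} :=
  fun x => `[< exists n r : A, n \in N /\ x = n + a * r >].

Lemma add_cyclicP : submod_closed add_cyclic.
Proof.
split=> [|b x y].
  by apply/asboolP; exists 0, 0; rewrite mulr0 addr0; split=> //; exact: (@rpred0 _ N).
move=> /asboolP[n [r [nN ->]]] /asboolP[m [q [mN ->]]].
apply/asboolP; exists (n * (b : A) + m), (r * (b : A) + q); split.
  exact: (rpredD (rpredZ b nN) mN).
have -> : b *: (n + a * r : (A^c)^o) = (n + a * r) * (b : A) :> A by [].
by rewrite mulrDl mulrDr mulrA addrACA.
Qed.
HB.instance Definition _ :=
  GRing.isSubmodClosed.Build A^c (A^c)^o add_cyclic add_cyclicP.

End AddCyclic.

Lemma maximal_colon (N : submodClosed (A^c)^o) (a : A) :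
  maximal_submod N -> a \notin N -> maximal_submod (colon N a).
Proof.
move=> [_ maxN] aN; split=> [|L subL].
  by exists 1; rewrite unfold_in /= mulr1.
have [[y [yL ayN]]|noy] := pselect (exists y : A, y \in L /\ a * y \notin N).
  right; have subK : {subset N <= add_cyclic N (a * y)}.
    by move=> n nN; apply/asboolP; exists n, 0; rewrite mulr0 addr0.
  have {maxN}[KN|Kfull] := maxN _ subK.
    case/negP: ayN; apply: KN; apply/asboolP.
    by exists 0, 1; rewrite mulr1 add0r; split=> //; exact: (@rpred0 _ N).
  have /asboolP[n [r [nN an]]] := Kfull (a : (A^c)^o).
  have yrL : y * r \in L by exact: (@rpredZ _ _ L (r : A^c) y).
  have : 1 - y * r \in L.
    apply: subL; change (a * (1 - y * r) \in N).
    by rewrite mulrBr mulr1 mulrA {1}an addrK.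
  move=> /(fun h => rpredD h yrL); rewrite subrK => oneL x.
  by rewrite -[x](mul1r (x : A)); exact: (@rpredZ _ _ L (x : A^c) (1 : A)).
left=> y yL; apply: contrapT => /negP ayN.
by apply: noy; exists y.
Qed.

Lemma jacobson_mull (a x : A) : x \in jacobson -> a * x \in jacobson.
Proof.
move=> /asboolP xJ; apply/asboolP=> N maxN.
have [aN|aN] := boolP ((a : (A^c)^o) \in N).
  exact: (@rpredZ _ _ N (x : A^c) a).
exact: xJ (maximal_colon maxN aN).
Qed.

Lemma jacobson_mulr (x a : A) : x \in jacobson -> x * a \in jacobson.
Proof. by move=> xJ; exact: (@rpredZ _ _ jacobson (a : A^c) x). Qed.

Definition radquo : Type := quomod jacobson.
HB.instance Definition _ := GRing.Zmodule.on radquo.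
HB.instance Definition _ := Quotient.on radquo.

Definition one_radquo : radquo := \pi_radquo 1.
Definition mul_radquo (u v : radquo) : radquo :=
  \pi_radquo ((repr u : A) * (repr v : A)).

Lemma pi_radquoP (x y : A) :
  \pi_radquo x = \pi_radquo y <-> x - y \in jacobson.
Proof. exact: pi_quomodP. Qed.

Lemma pi_radquoD (x y : A) :
  \pi_radquo (x + y) = \pi_radquo x + \pi_radquo y.
Proof. exact: pi_quomodD. Qed.

Lemma pi_radquoM (x y : A) :
  \pi_radquo (x * y) = mul_radquo (\pi_radquo x) (\pi_radquo y).
Proof.
apply/pi_radquoP; set x' : A := repr _; set y' : A := repr _.
have xx' : x - x' \in jacobson by apply/pi_radquoP; rewrite reprK.
have yy' : y - y' \in jacobson by apply/pi_radquoP; rewrite reprK.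
have -> : x * y - x' * y' = (x - x') * y + x' * (y - y').
  by rewrite mulrBl mulrBr addrA subrK.
exact: (rpredD (jacobson_mulr y xx') (jacobson_mull x' yy')).
Qed.

Lemma radquoW (u : radquo) : exists x : A, u = \pi_radquo x.
Proof. by exists (repr u); rewrite reprK. Qed.

Fact mul_radquoA : associative mul_radquo.
Proof.
move=> u v w; have [x ->] := radquoW u; have [y ->] := radquoW v.
have [z ->] := radquoW w.
by rewrite -(pi_radquoM y) -(pi_radquoM x) -(pi_radquoM x) -(pi_radquoM (x * y))
           mulrA.
Qed.
Fact mul_1radquo : left_id one_radquo mul_radquo.
Proof.
by move=> u; have [x ->] := radquoW u; rewrite -(pi_radquoM 1) mul1r.
Qed.
Fact mul_radquo1 : right_id one_radquo mul_radquo.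
Proof.
by move=> u; have [x ->] := radquoW u; rewrite -(pi_radquoM x 1) mulr1.
Qed.
Fact mul_radquoDl : left_distributive mul_radquo +%R.
Proof.
move=> u v w; have [x ->] := radquoW u; have [y ->] := radquoW v.
have [z ->] := radquoW w.
by rewrite -pi_radquoD -(pi_radquoM x) -(pi_radquoM y) -(pi_radquoM (x + y))
           -pi_radquoD mulrDl.
Qed.
Fact mul_radquoDr : right_distributive mul_radquo +%R.
Proof.
move=> u v w; have [x ->] := radquoW u; have [y ->] := radquoW v.
have [z ->] := radquoW w.
by rewrite -pi_radquoD -!(pi_radquoM x) -pi_radquoD mulrDr.
Qed.
HB.instance Definition _ := GRing.Zmodule_isPzRing.Build radquo
  mul_radquoA mul_1radquo mul_radquo1 mul_radquoDl mul_radquoDr.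

Definition semiperfect :=
  semisimple_mod (radquo^c)^o /\
  forall u : radquo, u * u = u ->
    exists2 f : A, f * f = f & \pi_radquo f = u.

End Rings.

Section Corner.
Variables (A : pzRingType) (f : A) (ff : f * f = f).

(* The proof ff is an argument so that the unit f can be found from the type. *)
Definition corner_pred (ff : f * f = f) : {pred A} :=
  fun x => `[< exists a, x = f * a * f >].
Definition corner : Type := {x : A | x \in corner_pred ff}.

Lemma corner_predP : zmod_closed (corner_pred ff).
Proof.
split=> [|x y]; first by apply/asboolP; exists 0; rewrite mulr0 mul0r.
move=> /asboolP[a ->] /asboolP[b ->]; apply/asboolP; exists (a - b).
by rewrite mulrBr mulrBl.
Qed.
HB.instance Definition _ :=
  GRing.isZmodClosed.Build A (corner_pred ff) corner_predP.
HB.instance Definition _ := SubChoice.on corner.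
HB.instance Definition _ := [SubChoice_isSubZmodule of corner by <:].

Lemma corner_val (x : corner) : f * val x = val x /\ val x * f = val x.
Proof.
by case: x => x /= /asboolP[a ->]; rewrite -!mulrA ff !mulrA ff.
Qed.

Fact corner_mul_in (x y : corner) : val x * val y \in corner_pred ff.
Proof.
apply/asboolP; exists (val x * val y).
by rewrite mulrA (corner_val x).1 -mulrA (corner_val y).2.
Qed.
Fact corner_one_in : f \in corner_pred ff.
Proof. by apply/asboolP; exists 1; rewrite mulr1 ff. Qed.

Definition corner_mul (x y : corner) : corner := Sub (val x * val y) (corner_mul_in x y).
Definition corner_one : corner := Sub f corner_one_in.

Fact corner_mulA : associative corner_mul.
Proof. by move=> x y z; apply: val_inj; rewrite /= mulrA. Qed.
Fact corner_mul1x : left_id corner_one corner_mul.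
Proof. by move=> x; apply: val_inj; exact: (corner_val x).1. Qed.
Fact corner_mulx1 : right_id corner_one corner_mul.
Proof. by move=> x; apply: val_inj; exact: (corner_val x).2. Qed.
Fact corner_mulDl : left_distributive corner_mul +%R.
Proof. by move=> x y z; apply: val_inj; rewrite /= mulrDl. Qed.
Fact corner_mulDr : right_distributive corner_mul +%R.
Proof. by move=> x y z; apply: val_inj; rewrite /= mulrDr. Qed.
HB.instance Definition _ := GRing.Zmodule_isPzRing.Build corner
  corner_mulA corner_mul1x corner_mulx1 corner_mulDl corner_mulDr.

End Corner.

Lemma idem_compl (A : pzRingType) (e : A) :
  e * e = e -> (1 - e) * (1 - e) = 1 - e.
Proof. by move=> ee; rewrite mulrBl mul1r mulrBr mulr1 ee subrr subr0. Qed.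

Section Algebras.
Variables (k : fieldType) (A : algType k).

(* A / rad A is, as a k-algebra, the product of the division algebras D i: the
   tuple of the p i is an isomorphism. *)
Definition basic :=
  exists (n : nat) (D : 'I_n -> unitAlgType k)
         (p : forall i, {rmorphism radquo A -> D i}),
    [/\ forall i (d : D i), d != 0 -> d \is a GRing.unit,
        forall i (c : k), p i (\pi_(radquo A) c%:A) = c%:A
      & bijective (fun (u : radquo A) (i : 'I_n) => p i u)].

Record pos_grading := PosGrading {
  gr_piece :> nat -> {pred A};
  gr_submod : forall i, submod_closed (gr_piece i);
  gr_span : forall a : A, exists n (x : nat -> A),
    (forall i, x i \in gr_piece i) /\ a = \sum_(i < n) x i;
  gr_free : forall n (x : nat -> A),
    (forall i, x i \in gr_piece i) -> \sum_(i < n) x i = 0 ->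
    forall i, (i < n)%N -> x i = 0;
  (* A_0 is isomorphic to k^n as a k-algebra. *)
  gr_degree0 : exists (n : nat) (phi : {rmorphism {ffun 'I_n -> k} -> A}),
    [/\ forall c : k, phi [ffun=> c] = c%:A, injective phi
      & forall a, a \in gr_piece 0 <-> exists x, phi x = a];
  (* A_i A_j = A_(i+j), where A_i A_j consists of the finite sums of products *)
  gr_mul : forall i j a, a \in gr_piece (i + j) <->
    exists n (x y : 'I_n -> A),
      [/\ forall t, x t \in gr_piece i, forall t, y t \in gr_piece j
        & a = \sum_t x t * y t]
}.

Definition graded_rad (G : pos_grading) : {pred (A^c)^o} :=
  fun a => `[< exists n (x : nat -> A),
    (forall i, x i \in G i.+1) /\ a = \sum_(i < n) x i >].

Lemma graded_rad_piece (G : pos_grading) i a : a \in G i.+1 -> a \in graded_rad G.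
Proof.
move=> aG; apply/asboolP; exists i.+1, (fun j => if j == i then a else 0).
split=> [j|]; first by case: eqP => [->|_] //; exact: (gr_submod G _).1.
rewrite (bigD1 ord_max) //= eqxx big1 ?addr0 // => j.
by rewrite -val_eqE /= => /negPf ->.
Qed.

Lemma graded_radD (G : pos_grading) (a b : A) :
  a \in graded_rad G -> b \in graded_rad G -> a + b \in graded_rad G.
Proof.
have GD i (x y : A) : x \in G i -> y \in G i -> x + y \in G i.
  by move=> xG yG; have := (gr_submod G i).2 1 x y xG yG; rewrite scale1r.
pose cut n (x : nat -> A) i := if (i < n)%N then x i else 0.
have cutG n x : (forall i, x i \in G i.+1) -> forall i, cut n x i \in G i.+1.
  by move=> xG i; rewrite /cut; case: ifP => // _; exact: (gr_submod G _).1.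
have cut_sum n m (x : nat -> A) : (n <= m)%N -> \sum_(i < n) x i = \sum_(i < m) cut n x i.
  move=> nm; rewrite (big_ord_widen_cond m (fun=> true) x nm).
  by rewrite [RHS](eq_bigr (fun i : 'I_m => if (i < n)%N then x i else 0)) //
             -big_mkcondr.
move=> /asboolP[n [x [xG ->]]] /asboolP[m [y [yG ->]]]; apply/asboolP.
exists (maxn n m), (fun i => cut n x i + cut m y i); split=> [i|].
  by apply: GD; apply: cutG.
by rewrite (cut_sum _ _ _ (leq_maxl n m)) (cut_sum _ _ _ (leq_maxr n m)) big_split.
Qed.

Lemma graded_rad0 (G : pos_grading) : 0 \in graded_rad G.
Proof. by apply: (@graded_rad_piece G 0); exact: (gr_submod G _).1. Qed.

Lemma graded_rad_sum (G : pos_grading) n (x : 'I_n -> A) :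
  (forall i, x i \in graded_rad G) -> \sum_i x i \in graded_rad G.
Proof.
by move=> xG; elim/big_ind: _ => //; [exact: graded_rad0|exact: graded_radD].
Qed.

Lemma graded_radP (G : pos_grading) : submod_closed (graded_rad G).
Proof.
split=> [|b x y]; first exact: graded_rad0.
move=> /asboolP[n [u [uG ->]]]; apply: graded_radD.
have [m [v [vG bE]]] := gr_span G (b : A).
change ((\sum_(i < n) u i) * (b : A) \in graded_rad G).
rewrite mulr_suml; apply: graded_rad_sum => i.
rewrite bE mulr_sumr; apply: graded_rad_sum => j.
apply: (@graded_rad_piece G (i + j)); rewrite -addSn; apply/gr_mul.
exists 1, (fun=> u i), (fun=> v j).
by split=> //; rewrite big_ord1.
Qed.

Variant setting :=
  | SemiperfectBasic of semiperfect A & basic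
  | PosGraded of pos_grading.

Definition radical (s : setting) : {pred (A^c)^o} :=
  match s with
  | SemiperfectBasic _ _ => @jacobson A
  | PosGraded G => graded_rad G
  end.

Definition degree0 (s : setting) (e : A) : Prop :=
  match s with
  | SemiperfectBasic _ _ => True
  | PosGraded G => e \in G 0
  end.

Lemma radicalP (s : setting) : submod_closed (radical s).
Proof.
case: s => [sA bA|G]; [exact: (@jacobsonP A)|exact: graded_radP].
Qed.
HB.instance Definition _ (s : setting) :=
  GRing.isSubmodClosed.Build A^c (A^c)^o (radical s) (radicalP s).

End Algebras.

Section Top.
Variables (A : nzRingType) (e : A).

Definition idem_mul (J : submodClosed (A^c)^o) : {pred (A^c)^o} :=
  fun x => `[< exists2 r : A, r \in J & x = e * r >].

Lemma idem_mulP J : submod_closed (idem_mul J).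
Proof.
split=> [|b x y].
  by apply/asboolP; exists 0; rewrite ?mulr0 //; exact: (@rpred0 _ J).
move=> /asboolP[r rJ ->] /asboolP[q qJ ->]; apply/asboolP.
exists (r * (b : A) + q); first exact: (rpredD (rpredZ b rJ) qJ).
by rewrite mulrDr mulrA.
Qed.
HB.instance Definition _ J :=
  GRing.isSubmodClosed.Build A^c (A^c)^o (idem_mul J) (idem_mulP J).

Definition full_ideal : {pred (A^c)^o} := fun=> true.
Fact full_idealP : submod_closed full_ideal. Proof. by []. Qed.
HB.instance Definition _ :=
  GRing.isSubmodClosed.Build A^c (A^c)^o full_ideal full_idealP.

End Top.

(* S_e = e A / e rad A, a right A-module *)
Definition top_mod (k : fieldType) (A : algType k) (s : setting A) (e : A) :
    lmodType A^c :=
  subquo (idem_mul e (@full_ideal A)) (idem_mul e (radical s)).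

(* Main.v *)
Require Import Defs.
From HB Require Import structures.
From mathcomp Require Import all_boot all_order all_algebra.
From mathcomp Require Import boolp classical_sets functions constructive_ereal.

Set Implicit Arguments.
Unset Strict Implicit.
Unset Printing Implicit Defensive.

Import Order.TTheory GRing.Theory Num.Theory.
Local Open Scope ring_scope.
Local Open Scope quotient_scope.

(** Put [f = 1 - e] and [Gamma = f A f], let [J] be the radical and
    [S = e A / e J]. The functor [M |-> M f] from right [A]-modules to right
    [Gamma]-modules is exact and essentially surjective, and it kills exactly
    the modules [V] with [V f = 0], called null below.

    The vanishing of Ext^1(S, S) forces [e J] to be contained in [A f A]:
    otherwise, by Nakayama's lemma, [e J / e J f A] has a nonzero quotient
    annihilated by [J]; this maps nontrivially to [S], and the resulting map
    extends to [A], so it vanishes on [e J] because [S J = 0]. Hence null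
    modules are annihilated by [J] ([null_J_null]), so they are semisimple, and
    each of them is a direct summand both of a direct sum and of a product of
    copies of [S]. Therefore Ext^i(W, V) = 0 for all null
    [W], [V] and all [i > 0], null modules have projective dimension at most
    pd S, and Ext^i(M, S) = 0 implies Ext^i(M, V) = 0 for all null [V]
    ([null_top_properties]).

    Call [N] good if it is generated by [N f] and Ext^i(N, V) = 0 for all null
    [V] and all [i > 0]. A good module has a resolution by direct sums of copies
    of [f A], on which the functor is fully faithful, so that
    pd N = pd (N f) ([good_pdle_corner], [corner_pdle_good]).

    If Ext^i(M, V) = 0 for all null [V] and [i > 0], then [M f A] is good, has
    the same corner as [M], and its projective dimension is at most
    max (pd M, pd S - 1). Shifting dimensions reduces the general case to this
    one and gives the bound on gl.dim Gamma ([pdle_corner]). This needs neither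
    minimal resolutions nor finitely generated modules.

    Conversely let [n = gl.dim Gamma]. If [P] is projective, then [P f A] is
    good, so it has projective dimension at most [n], and null modules, being
    direct summands of modules [P / P f A], have projective dimension at most
    [n + 1]. After [n] steps of resolving a module by direct sums of copies of
    [f A], up to null modules, a module whose corner is projective remains; its
    projective dimension is at most [n + 2]. So gl.dim A <= 2 n + 2
    ([pdle_of_corner]). *)

(** * Linear maps, submodules and quotients *)

Section LinearMaps.
Variables (R : pzRingType) (U V : lmodType R).

(** The function [f], with a proof of its linearity in its type. *)
Definition lin_fun (f : U -> V) (_ : linear f) : U -> V := f.
HB.instance Definition _ (f : U -> V) (fL : linear f) :=
  GRing.isLinear.Build R U V *:%R (lin_fun fL) fL.

Lemma linearW (f : U -> V) : linear f -> exists g : {linear U -> V}, g =1 f.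
Proof. by move=> fL; exists (lin_fun fL). Qed.

End LinearMaps.

Lemma quomod_projection (R : pzRingType) (M : lmodType R) (N : submodClosed M) :
  exists q : {linear M -> quomod N},
    (forall t, exists x, q x = t) /\ forall x, q x = 0 <-> x \in N.
Proof.
have qL : linear (\pi_(quomod N) : M -> quomod N).
  by move=> a x y; rewrite pi_quomodD pi_quomodZ.
have [q qE] := linearW qL; exists q; split=> [t|x].
  by exists (repr t); rewrite qE reprK.
by rewrite -(linear0 q) !qE -{2}[x]subr0; exact: pi_quomodP.
Qed.

Section SubmoduleOfProp.
Variables (R : pzRingType) (M : lmodType R) (P : M -> Prop).

(** [P] is the membership predicate of a submodule. *)
Definition sub_closed := P 0 /\ forall a x y, P x -> P y -> P (a *: x + y).

(** The submodule of the elements satisfying [P]. *)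
Definition prop_pred (_ : sub_closed) : {pred M} := fun x => `[< P x >].

Lemma prop_predP (H : sub_closed) : submod_closed (prop_pred H).
Proof.
split=> [|a x y]; first by apply/asboolP; exact: H.1.
by move=> /asboolP Px /asboolP Py; apply/asboolP; exact: H.2.
Qed.
HB.instance Definition _ (H : sub_closed) :=
  GRing.isSubmodClosed.Build R M (prop_pred H) (prop_predP H).

Lemma prop_submodP : sub_closed ->
  exists N : submodClosed M, forall x, (x \in N) <-> P x.
Proof.
move=> H; pose N : submodClosed M := GRing.SubmodClosed.clone _ _ (prop_pred H) _.
by exists N => x; split=> /asboolP.
Qed.

Lemma submodule_exists : sub_closed ->
  exists (X : lmodType R) (i : {linear X -> M}),
    injective i /\ forall m, P m <-> exists x, i x = m.
Proof.
move=> /prop_submodP[N NP]; exists (submod N), val; split; first exact: val_inj.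
move=> m; split=> [/NP mN|[x <-]]; last by apply/NP/valP.
by exists (exist _ m mN).
Qed.

Lemma quotient_exists : sub_closed ->
  exists (Y : lmodType R) (p : {linear M -> Y}),
    (forall y, exists m, p m = y) /\ forall m, p m = 0 <-> P m.
Proof.
move=> /prop_submodP[N NP].
have [p [pS pN]] := quomod_projection N; exists (quomod N), p; split=> // m.
by rewrite pN NP.
Qed.

End SubmoduleOfProp.

Section ExactSequences.
Variable R : pzRingType.
Implicit Types E K U V W X Y Z : lmodType R.

(** [ses i g]: the sequence 0 -> X -> Y -> Z -> 0 is exact. *)
Definition ses X Y Z (i : {linear X -> Y}) (g : {linear Y -> Z}) :=
  [/\ injective i, forall z, exists y, g y = z
    & forall y, g y = 0 <-> exists x, i x = y].

Lemma ses_comp0 X Y Z (i : {linear X -> Y}) (g : {linear Y -> Z}) x :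
  ses i g -> g (i x) = 0.
Proof. by case=> _ _ H; apply/H; exists x. Qed.

Lemma ses_surj X Y Z (i : {linear X -> Y}) (g : {linear Y -> Z}) z :
  ses i g -> exists y, g y = z.
Proof. by case. Qed.

Lemma lin_inj U V (f : {linear U -> V}) :
  (forall x, f x = 0 -> x = 0) -> injective f.
Proof.
move=> f0 x y fxy; apply/eqP; rewrite -subr_eq0; apply/eqP/f0.
by rewrite linearB fxy subrr.
Qed.

Lemma ker_exists Y Z (g : {linear Y -> Z}) : (forall z, exists y, g y = z) ->
  exists X (i : {linear X -> Y}), ses i g.
Proof.
move=> gS; have [|X [i [iI iP]]] := @submodule_exists _ _ (fun y => g y = 0).
  split=> [|a x y gx gy]; first exact: linear0.
  by rewrite linearP gx gy scaler0 addr0.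
by exists X, i.
Qed.

Lemma coker_exists X Y (i : {linear X -> Y}) : injective i ->
  exists Z (g : {linear Y -> Z}), ses i g.
Proof.
move=> iI.
have [|Z [g [gS gP]]] := @quotient_exists _ _ (fun y => exists x, i x = y).
  split=> [|a x y [u <-] [v <-]]; first by exists 0; rewrite linear0.
  by exists (a *: u + v); rewrite linearP.
by exists Z, g.
Qed.

(** A linear map with values in the image of an injective map factors
    through it. *)
Lemma lin_factor_inj X Y U (i : {linear X -> Y}) (f : {linear U -> Y}) :
  injective i -> (forall u, exists x, i x = f u) ->
  exists f' : {linear U -> X}, forall u, i (f' u) = f u.
Proof.
move=> iI /choice[f' f'E].
have f'L : linear f' by move=> a x y; apply: iI; rewrite linearP !f'E linearP.
by have [h hE] := linearW f'L; exists h => u; rewrite hE.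
Qed.

(** A linear map vanishing on the kernel of a surjective map factors
    through it. *)
Lemma lin_factor_surj Y Z V (g : {linear Y -> Z}) (f : {linear Y -> V}) :
  (forall z, exists y, g y = z) -> (forall y, g y = 0 -> f y = 0) ->
  exists f' : {linear Z -> V}, forall y, f' (g y) = f y.
Proof.
move=> /choice[s sE] f0.
have sf y z : g y = z -> f (s z) = f y.
  move=> gy; apply/eqP; rewrite -subr_eq0 -linearB; apply/eqP/f0.
  by rewrite linearB sE gy subrr.
have fL : linear (f \o s).
  by move=> a x y /=; rewrite -!linearP; apply: sf; rewrite linearP !sE.
have [h hE] := linearW fL; exists h => y.
by rewrite hE /=; apply: sf.
Qed.

(** [E], with [p] and [q], is the pullback of [g : Y -> Z] and [f : U -> Z]. *)
Definition is_pullback Y Z U E (g : {linear Y -> Z}) (f : {linear U -> Z})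
    (p : {linear E -> Y}) (q : {linear E -> U}) :=
  [/\ forall w, g (p w) = f (q w),
      forall w, p w = 0 -> q w = 0 -> w = 0
    & forall y u, g y = f u -> exists w, p w = y /\ q w = u].

Lemma pullback_exists Y Z U (g : {linear Y -> Z}) (f : {linear U -> Z}) :
  exists E (p : {linear E -> Y}) (q : {linear E -> U}), is_pullback g f p q.
Proof.
have [|E [i [iI iP]]] :=
    @submodule_exists _ (Y * U)%type (fun w => g w.1 = f w.2).
  split=> [|a x y gx gy /=]; first by rewrite /= !linear0.
  by rewrite !linearP gx gy.
have pL : linear (fun w => (i w).1) by move=> a x y; rewrite linearP.
have qL : linear (fun w => (i w).2) by move=> a x y; rewrite linearP.
have [[p pE] [q qE]] := (linearW pL, linearW qL).
exists E, p, q; split=> [w|w|y u gf].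
- by rewrite pE qE; apply/iP; exists w.
- rewrite pE qE => w1 w2; apply: iI; rewrite linear0.
  by case: (i w) w1 w2 => /= ? ? -> ->.
have /iP[w wE] : g (y, u).1 = f (y, u).2 by [].
by exists w; rewrite pE qE wE.
Qed.

Section Pullback.
Variables (Y Z U E : lmodType R) (g : {linear Y -> Z}) (f : {linear U -> Z}).
Variables (p : {linear E -> Y}) (q : {linear E -> U}).
Hypothesis pb : is_pullback g f p q.

Lemma pullback_sym : is_pullback f g q p.
Proof.
case: pb => pb1 pb2 pb3; split=> [w|w qw pw|u y fg]; first by rewrite pb1.
  exact: pb2.
by have [w [<- <-]] := pb3 _ _ (esym fg); exists w.
Qed.

Lemma pullback_inj w w' : p w = p w' -> q w = q w' -> w = w'.
Proof.
case: pb => _ pb2 _ pw qw; apply/eqP; rewrite -subr_eq0; apply/eqP.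
by apply: pb2; rewrite linearB ?pw ?qw subrr.
Qed.

Lemma pullback_lift W (u : {linear W -> Y}) (v : {linear W -> U}) :
  (forall w, g (u w) = f (v w)) ->
  exists h : {linear W -> E}, forall w, p (h w) = u w /\ q (h w) = v w.
Proof.
case: (pb) => _ _ pb3 guv; have /choice[h hE] w := pb3 _ _ (guv w).
have hL : linear h.
  by move=> a x y; apply: pullback_inj; rewrite linearP ?(hE _).1 ?(hE _).2 linearP.
by have [k kE] := linearW hL; exists k => w; rewrite kE.
Qed.

(** The two projections of a pullback have the same kernels as [f] and [g]. *)
Lemma pullback_ses K (i : {linear K -> Y}) : ses i g ->
  exists j : {linear K -> E}, ses j q /\ forall k, p (j k) = i k.
Proof.
case: (pb) => pb1 pb2 pb3 [iI gS ex].
have [k|j jE] := @pullback_lift K i \0.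
  by rewrite linear0; apply/ex; exists k.
exists j; split=> [|k]; last by rewrite (jE k).1.
split=> [x y jxy|u|w].
- by apply: iI; rewrite -!(jE _).1 jxy.
- by have [y yE] := gS (f u); have [w [_ wE]] := pb3 _ _ yE; exists w.
split=> [qw|[x <-]]; last by rewrite (jE x).2.
have /ex[x xE] : g (p w) = 0 by rewrite pb1 qw linear0.
by exists x; apply: pullback_inj; rewrite ?(jE _).1 ?(jE _).2.
Qed.

End Pullback.

End ExactSequences.

(** * Direct sums and projective modules *)

Section DirectSums.
Variable R : pzRingType.
Implicit Types (I : choiceType) (M N D V X Y Z P DX DY DZ : lmodType R).

(** [D] is the direct sum of copies of [M] indexed by [I], with inclusions
    [d i] and coordinates [c i]; the last clause says that every element is
    the finite sum of its components. *)
Record is_dsum I M D (d : I -> {linear M -> D}) (c : I -> {linear D -> M}) := {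
  dsumK : forall i m, c i (d i m) = m;
  dsumK0 : forall i j m, i != j -> c j (d i m) = 0;
  dsum_eq0 : forall x, (forall i, c i x = 0) -> x = 0;
  dsum_rec : forall N (h : I -> {linear M -> N}),
    exists g : {linear D -> N}, forall i m, g (d i m) = h i m;
  dsum_components : forall x (P : D -> Prop), P 0 ->
    (forall y z, P y -> P z -> P (y + z)) ->
    (forall i, P (d i (c i x))) -> P x
}.

Lemma dsum_ind I M D (d : I -> {linear M -> D}) (c : I -> {linear D -> M}) :
  is_dsum d c -> forall P : D -> Prop, P 0 ->
  (forall y z, P y -> P z -> P (y + z)) -> (forall i m, P (d i m)) ->
  forall x, P x.
Proof. by move=> dc P P0 PD Pd x; exact: (dsum_components dc). Qed.

(** A sum over a sequence containing the support of [F] does not depend on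
    the sequence. *)
Lemma big_uniq_support I M (s t : seq I) (F : I -> M) :
  uniq s -> uniq t -> (forall i, F i != 0 -> i \in s) ->
  (forall i, F i != 0 -> i \in t) ->
  \sum_(i <- s) F i = \sum_(i <- t) F i.
Proof.
move=> us ut sF tF.
have filt (r : seq I) : \sum_(i <- r) F i = \sum_(i <- [seq i <- r | F i != 0]) F i.
  rewrite big_filter [RHS]big_mkcond /=; apply: eq_bigr => i _.
  by have [->|] := eqVneq (F i) 0.
rewrite filt [RHS]filt; apply: perm_big; apply: uniq_perm.
- exact: filter_uniq.
- exact: filter_uniq.
by move=> i; rewrite !mem_filter; case: (boolP (F i != 0)) => //= h; rewrite sF ?tF.
Qed.

(** The product of copies of [M] indexed by [I]. *)
Definition fun_lmod (I : Type) M : lmodType R :=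
  GRing.Lmodule.clone R (I -> M) _.

Lemma dsum_exists I M :
  exists D (d : I -> {linear M -> D}) (c : I -> {linear D -> M}), is_dsum d c.
Proof.
have [|D [i [iI iP]]] := @submodule_exists R (fun_lmod I M)
    (fun x : I -> M => exists s : seq I, forall j, x j != 0 -> j \in s).
  split=> [|a x y [s sx] [t ty]]; first by exists [::] => j; rewrite eqxx.
  exists (s ++ t) => j xy; rewrite mem_cat; apply/orP.
  have [xj|xj] := eqVneq (x j) 0; last by left; exact: sx.
  right; apply: ty; apply: contraNneq xy => yj.
  by rewrite -[(a *: x + y) j]/(a *: x j + y j) xj yj scaler0 addr0.
pose del k (m : M) : I -> M := fun j => if j == k then m else 0.
have /choice[d0 d0E] (km : I * M) : exists u, i u = del km.1 km.2.
  apply/iP; exists [:: km.1] => j; rewrite inE /del.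
  by case: (j == km.1) => //; rewrite eqxx.
have /choice[d dE] k : exists h : {linear M -> D},
    forall m j, i (h m) j = if j == k then m else 0.
  have hL : linear (fun m => d0 (k, m)).
    move=> a x y; apply: iI; rewrite linearP !d0E /=; apply/funext => j.
    rewrite -[(a *: _ + _) j]/(a *: del k x j + del k y j) /del.
    by case: ifP => // _; rewrite scaler0 addr0.
  by have [h hE] := linearW hL; exists h => m j; rewrite hE d0E.
have /choice[c cE] j : exists h : {linear D -> M}, forall u, h u = i u j.
  have cL : linear (fun u => i u j) by move=> a x y; rewrite linearP.
  by have [h hE] := linearW cL; exists h.
exists D, d, c.
have coord u v : (forall j, i u j = i v j) -> u = v.
  by move=> uv; apply: iI; apply/funext.
have /choice[s sP] u : exists s : seq I, forall j, i u j != 0 -> j \in s.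
  by apply/iP; exists u.
split=> [k m|k j m|u u0|N h|u P P0 PD Pd].
- by rewrite cE dE eqxx.
- by rewrite eq_sym => /negPf kj; rewrite cE dE kj.
- by apply: coord => j; rewrite linear0 -cE u0.
- pose g u := \sum_(j <- undup (s u)) h j (i u j).
  have gE u t : uniq t -> (forall j, i u j != 0 -> j \in t) ->
      g u = \sum_(j <- t) h j (i u j).
    move=> ut ht.
    have hn0 j : h j (i u j) != 0 -> i u j != 0.
      by apply: contraNneq => ->; rewrite linear0.
    apply: big_uniq_support => // [|j /hn0|j /hn0]; first exact: undup_uniq.
      by rewrite mem_undup; exact: sP.
    exact: ht.
  have gL : linear g.
    move=> a x y.
    pose t := undup (s x ++ s y).
    have xt j : i x j != 0 -> j \in t by move=> h0; rewrite mem_undup mem_cat sP.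
    have yt j : i y j != 0 -> j \in t.
      by move=> h0; rewrite mem_undup mem_cat orbC sP.
    have xyE j : i (a *: x + y) j = a *: i x j + i y j by rewrite linearP.
    rewrite (gE x t) ?undup_uniq // (gE y t) ?undup_uniq //.
    rewrite (gE _ t) ?undup_uniq // => [|j]; last first.
      have [xj|/xt //] := eqVneq (i x j) 0.
      have [yj|/yt //] := eqVneq (i y j) 0.
      by rewrite xyE xj yj scaler0 addr0 eqxx.
    by rewrite scaler_sumr -big_split; apply: eq_bigr => j _; rewrite xyE linearP.
  have [G GE] := linearW gL; exists G => k m.
  rewrite GE (gE _ [:: k]) ?big_seq1 ?dE ?eqxx // => j.
  by rewrite dE inE; case: (j == k) => //; rewrite eqxx.
have -> : u = \sum_(j <- undup (s u)) d j (i u j).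
  apply: coord => j; rewrite linear_sum /= fct_sumE.
  under eq_bigr do rewrite dE.
  have [ju|ju] := boolP (j \in undup (s u)).
    rewrite (bigD1_seq j) ?undup_uniq //= eqxx big1 ?addr0 // => k.
    by rewrite eq_sym => /negPf ->.
  rewrite big_seq big1 => [|k ku]; last first.
    by case: eqP ku ju => // <- ->.
  by apply/eqP; apply: contraNT ju => /sP; rewrite mem_undup.
by elim/big_ind: _ => // j _; rewrite -cE; exact: Pd.
Qed.

(** The map between direct sums induced by [f]. *)
Section Dmap.
Variables (I : choiceType) (M N D E : lmodType R).
Variables (d : I -> {linear M -> D}) (c : I -> {linear D -> M}).
Variables (d' : I -> {linear N -> E}) (c' : I -> {linear E -> N}).
Hypotheses (dc : is_dsum d c) (dc' : is_dsum d' c').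

Lemma dsum_map (f : {linear M -> N}) : exists F : {linear D -> E},
  (forall i m, F (d i m) = d' i (f m)) /\ (forall i x, c' i (F x) = f (c i x)).
Proof.
have [F FE] := dsum_rec dc (fun i => d' i \o f : {linear M -> E}).
exists F; split=> // i; apply: (dsum_ind dc).
- by rewrite !linear0.
- by move=> y z yE zE; rewrite !linearD yE zE.
move=> j m; rewrite FE /=; have [->|ji] := eqVneq j i.
  by rewrite (dsumK dc') (dsumK dc).
by rewrite (dsumK0 dc') // (dsumK0 dc) // linear0.
Qed.

End Dmap.

Lemma dsum_ses I X Y Z DX DY DZ (dX : I -> {linear X -> DX}) cX
    (dY : I -> {linear Y -> DY}) cY (dZ : I -> {linear Z -> DZ}) cZ
    (i : {linear X -> Y}) (g : {linear Y -> Z}) :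
  is_dsum dX cX -> is_dsum dY cY -> is_dsum dZ cZ -> ses i g ->
  exists (i' : {linear DX -> DY}) (g' : {linear DY -> DZ}),
    ses i' g' /\ forall j x, i' (dX j x) = dY j (i x).
Proof.
move=> hX hY hZ [iI gS ex].
have [i' [i'd i'c]] := dsum_map hX hY i; have [g' [g'd g'c]] := dsum_map hY hZ g.
exists i', g'; split=> //; split.
- apply: lin_inj => x ix0; apply: (dsum_eq0 hX) => j.
  by apply: iI; rewrite -i'c ix0 !linear0.
- apply: (dsum_ind hZ) => [|y z [u <-] [v <-]|j m].
  + by exists 0; rewrite linear0.
  + by exists (u + v); rewrite linearD.
  + by have [y <-] := gS m; exists (dY j y).
- move=> y; split=> [gy0|[x <-]]; last first.
    apply: (dsum_eq0 hZ) => j; rewrite g'c i'c.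
    by apply/ex; exists (cX j x).
  apply: (dsum_components hY (x := y) (P := fun z => exists x, i' x = z))
    => [|u v [x <-] [z <-]|j].
  + by exists 0; rewrite linear0.
  + by exists (x + z); rewrite linearD.
  + have /ex[x xE] : g (cY j y) = 0 by rewrite -g'c gy0 linear0.
    by exists (dX j x); rewrite i'd xE.
Qed.

Lemma dsum_projective I M D (d : I -> {linear M -> D}) c :
  is_dsum d c -> projective M -> projective D.
Proof.
move=> dc pM U V g f gS.
have /choice[h hE] i : exists h : {linear M -> U}, forall m, g (h m) = f (d i m).
  exact: (pM U V g (f \o d i : {linear M -> V})).
have [H HE] := dsum_rec dc h; exists H.
apply: (dsum_ind dc) => [|y z yE zE|i m]; first by rewrite !linear0.
  by rewrite !linearD yE zE.
by rewrite HE.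
Qed.

Lemma regular_projective : projective R^o.
Proof.
move=> U V g f gS; have [u uE] := gS (f 1).
have hL : linear (fun a : R^o => (a : R) *: u).
  by move=> a x y; rewrite scalerDl scalerA.
exists (lin_fun hL) => x; rewrite /lin_fun linearZ /= uE -linearZ /=.
by congr (f _); exact: mulr1.
Qed.

Lemma enough_projectives M : exists X P (i : {linear X -> P}) (g : {linear P -> M}),
  ses i g /\ projective P.
Proof.
have [P [d [c dc]]] := dsum_exists M (R^o : lmodType R).
have hL (m : M) : linear (fun a : R^o => (a : R) *: m).
  by move=> a x y; rewrite scalerDl scalerA.
have [g gE] := dsum_rec dc (fun m => lin_fun (hL m)).
have [|X [i ig]] := @ker_exists _ _ _ g.
  by move=> m; exists (d m 1); rewrite gE; exact: scale1r.
exists X, P, i, g; split=> //.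
exact: (dsum_projective dc regular_projective).
Qed.

End DirectSums.

(** * Vanishing of Ext *)

Section Ext.
Variable R : pzRingType.
Implicit Types E K L M N P Q U V W X Y Z : lmodType R.

(** Hom(M, V) = 0. *)
Definition hom0 M V := forall (h : {linear M -> V}) x, h x = 0.

(** Ext^1(M, V) = 0: the maps from the kernel of a surjection onto [M] to [V]
    extend. *)
Definition ext1 M V := forall X E (i : {linear X -> E}) (g : {linear E -> M}),
  ses i g -> forall h : {linear X -> V},
  exists h' : {linear E -> V}, forall x, h' (i x) = h x.

(** [ext n M V] means that Ext^(n+1)(M, V) = 0. It is defined by dimension
    shifting along all projective presentations of [M]; one suffices, see
    [ext_shift]. *)
Fixpoint ext n M V : Prop :=
  if n is m.+1 then
    forall X P (i : {linear X -> P}) (g : {linear P -> M}),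
      ses i g -> projective P -> ext m X V
  else ext1 M V.

(** The identity of [X] is the sum of a map factoring through [Y] and a map
    factoring through a projective module. For [i > 0], the vanishing of
    Ext^i(Y, V) then implies that of Ext^i(X, V); any two first syzygies of a
    module are related in this way. *)
Definition stable_retract X Y :=
  exists P (a : {linear X -> Y}) (b : {linear Y -> X})
         (t : {linear X -> P}) (s : {linear P -> X}),
    projective P /\ forall x, x = b (a x) + s (t x).

Lemma ext1_stable X Y V : stable_retract X Y -> ext1 Y V -> ext1 X V.
Proof.
move=> [P [a [b [t [s [pP xE]]]]]] eY K E i g ig h.
have [F [p [q pb]]] := pullback_exists g b.
have [j [jq jE]] := pullback_ses pb ig.
have [k kE] := eY _ _ _ _ jq h.
case: (ig) => _ gS _; have [sg sgE] := pP _ _ g s gS.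
(* The map (id - sg t g, a g) from [E] to the pullback restricts to [j] on [K]. *)
have uvE e : g ((idfun \- (sg \o t \o g)) e) = b ((a \o g) e).
  by rewrite /= linearB /= sgE {1}[g e]xE addrK.
have [w wE] := pullback_lift pb uvE.
exists (k \o w) => x /=; rewrite -kE; congr (k _).
case: (jq) => _ _ jq0; have qj : q (j x) = 0 by apply/jq0; exists x.
apply: (pullback_inj pb); rewrite ?jE ?qj ?(wE _).1 ?(wE _).2 /=.
  by rewrite (ses_comp0 _ ig) !linear0 addr0.
by rewrite (ses_comp0 _ ig) linear0.
Qed.

(** The syzygies of a stable retract are stable retracts of the syzygies. *)
Lemma stable_retract_syzygy X Y X1 P Y1 Q
    (i : {linear X1 -> P}) (g : {linear P -> X})
    (j : {linear Y1 -> Q}) (f : {linear Q -> Y}) :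
  ses i g -> projective P -> ses j f -> projective Q ->
  stable_retract X Y -> stable_retract X1 Y1.
Proof.
move=> [iI gS ig] pP [jI fS jf] pQ [T [a [b [t [s [pT xE]]]]]].
have [a' a'E] := pP _ _ f (a \o g) fS.
have [b' b'E] := pQ _ _ g (b \o f) gS.
have [s' s'E] := pT _ _ g s gS.
have [a1 a1E] : exists h : {linear X1 -> Y1}, forall x, j (h x) = a' (i x).
  apply: (@lin_factor_inj _ _ _ _ j (a' \o i) jI) => x.
  apply/jf; rewrite a'E /=; have -> : g (i x) = 0 by apply/ig; exists x.
  by rewrite linear0.
have [b1 b1E] : exists h : {linear Y1 -> X1}, forall y, i (h y) = b' (j y).
  apply: (@lin_factor_inj _ _ _ _ i (b' \o j) iI) => y.
  apply/ig; rewrite b'E /=; have -> : f (j y) = 0 by apply/jf; exists y.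
  by rewrite linear0.
have [u uE] : exists h : {linear P -> X1}, forall x,
    i (h x) = x - b' (a' x) - s' (t (g x)).
  apply: (@lin_factor_inj _ _ _ _ i
           (idfun \- (b' \o a') \- (s' \o t \o g)) iI) => x.
  apply/ig; rewrite /= !linearB /= b'E /= a'E s'E /= {1}[g x]xE.
  by rewrite addrAC addrK subrr.
exists P, a1, b1, i, u; split=> // x; apply: iI.
rewrite linearD b1E a1E uE; have -> : g (i x) = 0 by apply/ig; exists x.
by rewrite !linear0 addr0 addrC subrK.
Qed.

Lemma ext_stable n X Y V : stable_retract X Y -> ext n Y V -> ext n X V.
Proof.
elim: n X Y => [|n IH] X Y XY /=; first exact: ext1_stable.
move=> eY X1 P i g ig pP.
have [Y1 [Q [j [f [jf pQ]]]]] := enough_projectives Y.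
by apply: (IH _ Y1); [exact: (stable_retract_syzygy ig pP jf pQ XY)|exact: eY jf pQ].
Qed.

Lemma retract_stable X Y (a : {linear X -> Y}) (b : {linear Y -> X}) :
  (forall x, b (a x) = x) -> stable_retract X Y.
Proof.
move=> ba; exists (R^o : lmodType R), a, b, \0, \0.
by split=> [|x]; [exact: regular_projective|rewrite ba /= addr0].
Qed.

Lemma stable_refl X : stable_retract X X.
Proof. exact: (@retract_stable X X idfun idfun). Qed.

Lemma ext_retract n X Y V (a : {linear X -> Y}) (b : {linear Y -> X}) :
  (forall x, b (a x) = x) -> ext n Y V -> ext n X V.
Proof. by move=> ba; apply: ext_stable; exact: retract_stable ba. Qed.

Lemma ext_shift n M V X P (i : {linear X -> P}) (g : {linear P -> M}) :
  ses i g -> projective P -> ext n X V -> ext n.+1 M V.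
Proof.
move=> ig pP eX X' P' i' g' ig' pP'; apply: ext_stable eX.
exact: (stable_retract_syzygy ig' pP' ig pP (stable_refl M)).
Qed.

(** Vanishing of Ext^1 can be tested on one projective presentation. *)
Lemma ext1_presentation M V X P (i : {linear X -> P}) (g : {linear P -> M}) :
  ses i g -> projective P ->
  (forall h : {linear X -> V}, exists h' : {linear P -> V}, forall x, h' (i x) = h x) ->
  ext1 M V.
Proof.
move=> [iI gS ex] pP ext_h Y E j f [jI fS jf] h.
have [u uE] := pP _ _ f g fS.
have [v vE] : exists v : {linear X -> Y}, forall x, j (v x) = u (i x).
  apply: (@lin_factor_inj _ _ _ _ j (u \o i) jI) => x.
  by apply/jf; rewrite /= uE; apply/ex; exists x.
have [k kE] := ext_h (h \o v).
have pL : linear (fun w : P * Y => u w.1 + j w.2).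
  by move=> a x y; rewrite !linearP scalerDr addrACA.
have qL : linear (fun w : P * Y => k w.1 + h w.2).
  by move=> a x y; rewrite !linearP scalerDr addrACA.
have [[p pE] [q qE]] := (linearW pL, linearW qL).
have [e|w|H HE] := @lin_factor_surj _ _ _ _ p q.
- have [x xE] := gS (f e).
  have /jf[y yE] : f (e - u x) = 0 by rewrite linearB uE xE subrr.
  by exists (x, y); rewrite pE /= yE addrC subrK.
- rewrite pE qE => w0; have /ex[x xE] : g w.1 = 0.
    rewrite -uE; have := congr1 f w0; rewrite linearD linear0.
    by have -> : f (j w.2) = 0 by [apply/jf; exists w.2]; rewrite addr0.
  have -> : w.2 = - v x.
    by apply: jI; rewrite linearN vE xE; apply/eqP; rewrite -addr_eq0 addrC w0.
  by rewrite linearN -xE kE /= subrr.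
exists H => y; have -> : j y = p (0, y) by rewrite pE /= linear0 add0r.
by rewrite HE qE /= linear0 add0r.
Qed.

Lemma trivial_projective P : (forall x : P, x = 0) -> projective P.
Proof. by move=> P0 U V g f gS; exists \0 => x; rewrite (P0 x) !linear0. Qed.

Lemma ses_trivial X Y Z (i : {linear X -> Y}) (g : {linear Y -> Z}) :
  ses i g -> (forall y, g y = 0 -> y = 0) -> forall x : X, x = 0.
Proof.
move=> ig g0 x; case: (ig) => iI _ _; apply: iI; rewrite linear0.
by apply: g0; exact: ses_comp0 ig.
Qed.

Lemma projective_ext n P V : projective P -> ext n P V.
Proof.
elim: n P => [|n IH] P pP.
  all: have [|P0 [o oi]] := @ker_exists _ P P idfun; first by move=> z; exists z.
  all: have P00 := ses_trivial oi (fun y y0 => y0).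
  by apply: (ext1_presentation oi pP) => h; exists \0 => x; rewrite (P00 x) !linear0.
by apply: (ext_shift oi pP); exact/IH/trivial_projective.
Qed.

Lemma ext1_projective M : (forall V, ext1 M V) -> projective M.
Proof.
move=> eM U V g f gS; have [E [p [q pb]]] := pullback_exists g f.
have [X [i ig]] := ker_exists gS; have [j [jq jE]] := pullback_ses pb ig.
have [r rE] := eM X _ _ _ _ jq idfun.
have [w|w|h hE] := @lin_factor_surj _ _ _ _ q (p \- (i \o r)).
- by case: jq => _ qS _; exact: qS.
- case: (jq) => _ _ je; move=> /je[x <-] /=; rewrite rE /= jE subrr //.
exists h => x; case: (jq) => _ qS _; have [w <-] := qS x.
rewrite hE /= linearB /= (ses_comp0 _ ig) subr0.
by case: pb.
Qed.

(** * Long exact sequence *)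

(** The kernel of [g \o p] is the inverse image under [p] of the submodule [X]
    of [Y]. *)
Lemma preimage_ses X Y Z P W (i : {linear X -> Y}) (g : {linear Y -> Z})
    (p : {linear P -> Y}) (z : {linear W -> P}) (r : {linear W -> X}) :
  ses i g -> (forall y, exists a, p a = y) -> is_pullback p i z r ->
  ses z (g \o p).
Proof.
move=> [iI gS ig] pS [pb1 pb2 pb3]; split=> [|y|y].
- apply: lin_inj => w zw; apply: pb2 => //.
  by apply: iI; rewrite -pb1 zw !linear0.
- by have [a <-] := gS y; have [b <-] := pS a; exists b.
- split=> [/ig[x xE]|[w <-]]; last by apply/ig; exists (r w); rewrite pb1.
  by have [w [<- _]] := pb3 _ _ (esym xE); exists w.
Qed.

(** The inverse image [W] of [X] in a cover [P] of [Y] is a first syzygy of [Z],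
    and an extension of [X] by the first syzygy [K] of [Y]. *)
Lemma ses_rotate X Y Z K P (i : {linear X -> Y}) (g : {linear Y -> Z})
    (o : {linear K -> P}) (p : {linear P -> Y}) :
  ses i g -> ses o p ->
  exists W (z : {linear W -> P}) (f : {linear P -> Z})
         (u : {linear K -> W}) (r : {linear W -> X}),
    [/\ ses z f, ses u r, forall w, i (r w) = p (z w) & forall k, z (u k) = o k].
Proof.
move=> ig op; have [W [z [r pb]]] := pullback_exists p i.
have [u [ur uE]] := pullback_ses pb op.
exists W, z, (g \o p), u, r; split=> //; last by case: pb.
by apply: (preimage_ses ig _ pb); case: op.
Qed.

Lemma ext1_mid X Y Z V (i : {linear X -> Y}) (g : {linear Y -> Z}) :
  ses i g -> ext1 X V -> ext1 Z V -> ext1 Y V.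
Proof.
move=> ig eX eZ K E j p jp h.
have [F [q [r pb]]] := pullback_exists p i.
have [k [kr kE]] := pullback_ses pb jp; have [h1 h1E] := eX _ _ _ _ kr h.
have qgp : ses q (g \o p) by apply: (preimage_ses ig _ pb); case: jp.
have [H HE] := eZ _ _ _ _ qgp h1; exists H => x.
by rewrite -kE HE h1E.
Qed.

Lemma ext1_left X Y Z V (i : {linear X -> Y}) (g : {linear Y -> Z}) :
  ses i g -> ext1 Y V -> ext 1 Z V -> ext1 X V.
Proof.
move=> ig eY eZ K E j p jp h.
have [O [P [o [c [oc pP]]]]] := enough_projectives Y.
have [W [z [f [u [r [zf ur irz zu]]]]]] := ses_rotate ig oc.
have [F [p1 [q1 pb]]] := pullback_exists p r.
have [j1 [j1q j1E]] := pullback_ses pb jp.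
have [j2 [j2p j2E]] := pullback_ses (pullback_sym pb) ur.
have [h1 h1E] := eZ _ _ _ _ zf pP _ _ _ _ j1q h.
(* [h1] is corrected by a map defined on [P] so that it descends to [E]. *)
have [k kE] := eY _ _ _ _ oc (h1 \o j2).
have [e|w|H HE] := @lin_factor_surj _ _ _ _ p1 (h1 \- (k \o z \o q1)).
- by case: j2p => _ S _; exact: S.
- by case: (j2p) => _ _ je; move=> /je[x <-] /=; rewrite j2E zu kE /= subrr.
exists H => x; rewrite -j1E HE /= h1E.
by rewrite (ses_comp0 _ j1q) !linear0 addr0.
Qed.

(** The consequences of the long exact sequence for vanishing. For the rotated
    sequence the degrees drop by one and the three statements are permuted. *)
Lemma ext_long_exact n X Y Z V (i : {linear X -> Y}) (g : {linear Y -> Z}) :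
  ses i g ->
  [/\ ext n X V -> ext n Z V -> ext n Y V,
      ext n Y V -> ext n.+1 Z V -> ext n X V
    & ext n X V -> ext n.+1 Y V -> ext n.+1 Z V].
Proof.
elim: n X Y Z i g => [|n IH] X Y Z i g ig.
  split; [exact: ext1_mid ig|exact: ext1_left ig|] => eX eY.
  have [O [P [o [c [oc pP]]]]] := enough_projectives Y.
  have [W [z [f [u [r [zf ur _ _]]]]]] := ses_rotate ig oc.
  by apply: (ext_shift zf pP); apply: (ext1_mid ur) => //; exact: eY oc pP.
have mid X' Y' Z' (i' : {linear X' -> Y'}) (g' : {linear Y' -> Z'}) :
    ses i' g' -> ext n.+1 X' V -> ext n.+1 Z' V -> ext n.+1 Y' V.
  move=> ig' eX eZ K P o c oc pP.
  have [W [z [f [u [r [zf ur _ _]]]]]] := ses_rotate ig' oc.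
  by have [_ left _] := IH _ _ _ _ _ ur; apply: left => //; exact: eZ zf pP.
split; first exact: mid ig.
  move=> eY eZ; have [O [P [o [c [oc pP]]]]] := enough_projectives Y.
  have [W [z [f [u [r [zf ur _ _]]]]]] := ses_rotate ig oc.
  have [_ _ right] := IH _ _ _ _ _ ur.
  by apply: right; [exact: eY oc pP|exact: eZ zf pP].
move=> eX eY; have [O [P [o [c [oc pP]]]]] := enough_projectives Y.
have [W [z [f [u [r [zf ur _ _]]]]]] := ses_rotate ig oc.
apply: (ext_shift zf pP); apply: (mid _ _ _ _ _ ur) => //.
exact: eY oc pP.
Qed.

End Ext.

(** * Projective and injective dimension *)

Lemma least_leP (P : nat -> Prop) n :
  (least P <= (Posz n)%:E)%E <-> exists2 m, (m <= n)%N & P m.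
Proof.
rewrite /least; case: pselect => [exP|nexP]; last first.
  split=> [|[m _ Pm]]; first by rewrite leye_eq.
  by case: nexP; exists m; apply/asboolP.
case: ex_minnP => m /asboolP Pm mmin; rewrite lee_fin lez_nat.
split=> [mn|[j jn Pj]]; first by exists m.
by apply: leq_trans jn; apply: mmin; apply/asboolP.
Qed.

Section Dimension.
Variable R : pzRingType.
Implicit Types D E I J K L M N O P Q U V W X Y Z : lmodType R.

Lemma ext_retract2 n M V W (a : {linear V -> W}) (b : {linear W -> V}) :
  (forall x, b (a x) = x) -> ext n M W -> ext n M V.
Proof.
move=> ba; elim: n M => [|n IH] M eM X P i g ig => [h|pP].
  have [k kE] := eM _ _ _ _ ig (a \o h).
  by exists (b \o k) => x /=; rewrite kE /= ba.
by apply: IH; exact: eM ig pP.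
Qed.

Lemma ext_dsum n (I : choiceType) M D V (d : I -> {linear M -> D}) c :
  is_dsum d c -> ext n M V -> ext n D V.
Proof.
elim: n M D d c => [|n IH] M D d c dc eM.
  all: have [X [P [i [g [ig pP]]]]] := enough_projectives M.
  all: have [DX [dX [cX hX]]] := dsum_exists I X.
  all: have [DP [dP [cP hP]]] := dsum_exists I P.
  all: have [i' [g' [ig' i'E]]] := dsum_ses hX hP dc ig.
  all: have pDP := dsum_projective hP pP.
  apply: (ext1_presentation ig' pDP) => h.
  have /choice[k kE] j : exists k : {linear P -> V}, forall x, k (i x) = h (dX j x).
    exact: (eM _ _ _ _ ig (h \o dX j)).
  have [H HE] := dsum_rec hP k; exists H.
  apply: (dsum_ind hX) => [|y z yE zE|j x]; first by rewrite !linear0.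
    by rewrite !linearD yE zE.
  by rewrite i'E HE kE.
apply: (ext_shift ig' pDP); apply: (IH _ _ _ _ hX); exact: eM ig pP.
Qed.

Lemma ext_prod n (I : Type) M V : ext n M V -> ext n M (fun_lmod I V).
Proof.
elim: n M => [|n IH] M eM X P i g ig => [h|pP]; last by apply: IH; exact: eM ig pP.
have hL j : linear (fun x => (h x : I -> V) j) by move=> a x y; rewrite linearP.
have /choice[k kE] j : exists k : {linear P -> V}, forall x, k (i x) = (h x : I -> V) j.
  by have [hj hjE] := linearW (hL j); have [k kE] := eM _ _ _ _ ig hj;
     exists k => x; rewrite kE hjE.
have kL : linear (fun p => (fun j => k j p) : fun_lmod I V).
  by move=> a x y; apply/funext => j; rewrite linearP.
have [H HE] := linearW kL; exists H => x.
by rewrite HE; apply/funext => j; exact: kE.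
Qed.

(** Dimension shifting in the second argument. *)
Lemma ext_shift2 n M V I W (v : {linear V -> I}) (p : {linear I -> W}) :
  ses v p -> injective_mod I -> ext n M W -> ext n.+1 M V.
Proof.
move=> [vI pS ex] injI; elim: n M => [|n IH] M eM X P i g ig pP; last first.
  by apply: IH; exact: eM ig pP.
have [O [Q [o [c [oc pQ]]]]] := enough_projectives X.
apply: (ext1_presentation oc pQ) => h; case: (oc) => oI cS oe.
have [k kE] := injI _ _ o (v \o h) oI.
have [|l lE] := @lin_factor_surj _ _ _ _ c (p \o k) cS.
  by move=> q /oe[y <-]; rewrite /= kE; apply/ex; exists (h y).
have [m mE] := eM _ _ _ _ ig l.
have [m' m'E] := pP _ _ p m pS.
have [q|h' h'E] := @lin_factor_inj _ _ _ _ v (k \- (m' \o i \o c)) vI.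
  by apply/ex; rewrite /= linearB /= m'E mE lE subrr.
exists h' => x; apply: vI; rewrite h'E /= kE.
by rewrite (ses_comp0 _ oc) !linear0 addr0.
Qed.

Lemma injective_ext1 M I : injective_mod I -> ext1 M I.
Proof. by move=> injI X E i g [iI _ _] h; exact: injI. Qed.

(** A bijective linear map has a linear inverse. *)
Lemma bij_retract X Y (f : {linear X -> Y}) :
  (forall x, f x = 0 -> x = 0) -> (forall y, exists x, f x = y) ->
  exists g : {linear Y -> X}, (forall x, g (f x) = x) /\ forall y, f (g y) = y.
Proof.
move=> /lin_inj fI fS.
have [|g gE] := @lin_factor_inj _ _ _ _ f (idfun : {linear Y -> Y}) fI; first exact: fS.
by exists g; split=> [x|y]; [apply: fI|]; rewrite gE.
Qed.

Lemma image_exists X Y (f : {linear X -> Y}) :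
  exists K (i : {linear K -> Y}) (q : {linear X -> K}),
    [/\ injective i, forall k, exists x, q x = k & forall x, i (q x) = f x].
Proof.
have [|K [i [iI iP]]] := @submodule_exists _ _ (fun y => exists x, f x = y).
  split=> [|a x y [u <-] [v <-]]; first by exists 0; rewrite linear0.
  by exists (a *: u + v); rewrite linearP.
have [x|q qE] := @lin_factor_inj _ _ _ _ i f iI; first by apply/iP; exists x.
exists K, i, q; split=> // k; have /iP[x xE] : exists k', i k' = i k by exists k.
by exists x; apply: iI; rewrite qE.
Qed.

(** [M] has projective dimension at most [n]. *)
Definition pdle n M := forall V, ext n M V.

Lemma pdleS n M : pdle n M -> pdle n.+1 M.
Proof.
elim: n M => [|n IH] M pM V X P i g ig pP; last first.
  by apply: (IH X) => W; exact: pM ig pP.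
have /ext1_projective pM' := pM.
have [s sE] := pM' _ _ g idfun (fun z => ses_surj z ig).
have [iI gS ie] := ig.
have [y|r rE] := @lin_factor_inj _ _ _ _ i (idfun \- (s \o g)) iI.
  by apply/ie; rewrite /= linearB /= sE subrr.
apply: (@ext1_stable _ X P V); last exact: (projective_ext 0).
apply: (@retract_stable _ X P i r) => x.
by apply: iI; rewrite rE /= (ses_comp0 _ ig) !linear0 addr0.
Qed.

Lemma pdle_leq n m M : (n <= m)%N -> pdle n M -> pdle m M.
Proof.
move=> /subnKC <-; elim: (m - n)%N => [|k IH] pM; rewrite ?addn0 // addnS.
exact/pdleS/IH.
Qed.

Lemma pdle_stable n X Y : stable_retract X Y -> pdle n Y -> pdle n X.
Proof. by move=> XY pY V; exact: ext_stable XY (pY V). Qed.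

Lemma pdle_retract n X Y (a : {linear X -> Y}) (b : {linear Y -> X}) :
  (forall x, b (a x) = x) -> pdle n Y -> pdle n X.
Proof. by move=> /retract_stable; exact: pdle_stable. Qed.

Lemma pdle0 M : pdle 0 M <-> projective M.
Proof. by split=> [/ext1_projective//|pM V]; exact: (projective_ext 0). Qed.

Lemma projective_pdle n M : projective M -> pdle n M.
Proof. by move=> pM V; exact: projective_ext. Qed.

Lemma pdle_ses n X Y Z (i : {linear X -> Y}) (g : {linear Y -> Z}) :
  ses i g ->
  [/\ pdle n X -> pdle n Z -> pdle n Y,
      pdle n Y -> pdle n.+1 Z -> pdle n X
    & pdle n X -> pdle n.+1 Y -> pdle n.+1 Z].
Proof.
move=> ig; split=> h1 h2 V; have [a b c] := @ext_long_exact _ n _ _ _ V _ _ ig.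
- exact: a (h1 V) (h2 V).
- exact: b (h1 V) (h2 V).
- exact: c (h1 V) (h2 V).
Qed.

(** The images of the differentials are syzygies, and the last one is
    projective. *)
Lemma resolution_pdle n M (P : proj_resolution M) : vanishes_above P n -> pdle n M.
Proof.
move=> vP.
have im m j K (i : {linear K -> P j}) (q : {linear P j.+1 -> K}) :
    injective i -> (forall k, exists x, q x = k) ->
    (forall x, i (q x) = pr_diff P j x) ->
    vanishes_above P (j + m).+1 -> pdle m K.
  elim: m j K i q => [|m IH] j K i q iI qS qE vj.
    have q0 x : q x = 0 -> x = 0.
      move=> qx; have /pr_exact[y <-] : pr_diff P j x = 0 by rewrite -qE qx linear0.
      by rewrite (vj j.+2 _ y) ?linear0 // addn0.
    have [q' [q'q qq']] := bij_retract q0 qS.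
    apply: (pdle_retract qq'); apply: projective_pdle; exact: pr_projective.
  have [L [o [c [oI cS cE]]]] := image_exists (pr_diff P j.+1).
  have oq : ses o q.
    split=> // x; split=> [qx|[l <-]].
      have /pr_exact[y <-] : pr_diff P j x = 0 by rewrite -qE qx linear0.
      by exists (c y); rewrite cE.
    apply: iI; have [y <-] := cS l.
    by rewrite linear0 qE cE; apply/pr_exact; exists y.
  move=> V; apply: (ext_shift oq (@pr_projective _ _ P _)).
  by apply: (IH j.+1 L o c) => //; rewrite addSnnS.
have [K [i [q [iI qS qE]]]] := image_exists (pr_diff P 0).
have iP : ses i (pr_aug P).
  split=> //; first exact: pr_aug_surj.
  move=> y; split=> [/pr_exact0[x <-]|[k <-]]; first by exists (q x); rewrite qE.
  by have [x <-] := qS k; rewrite qE; apply/pr_exact0; exists x.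
case: n vP => [|n] vP V.
  have pK : pdle 0 K.
    apply/pdle0/trivial_projective => k; have [x <-] := qS k.
    by rewrite (vP 1%N _ x) // linear0.
  have a0 x : pr_aug P x = 0 -> x = 0.
    by move=> /pr_exact0[y <-]; rewrite (vP 1%N _ y) // linear0.
  have [b [ba ab]] := bij_retract a0 (@pr_aug_surj _ _ P).
  apply: (pdle_retract ab); apply: projective_pdle; exact: pr_projective.
apply: (ext_shift iP (@pr_projective _ _ P _)).
exact: (im n 0%N K i q).
Qed.

(** A projective presentation of [M], trivial when [M] is projective; it is
    iterated to obtain a resolution of the least possible length. *)
Record presentation M := Presentation {
  prs_ker : lmodType R;
  prs_obj : lmodType R;
  prs_inj : {linear prs_ker -> prs_obj};
  prs_map : {linear prs_obj -> M};
  prs_ses : ses prs_inj prs_map;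
  prs_projective : projective prs_obj;
  prs_trivial : projective M -> forall x, prs_map x = 0 -> x = 0
}.

Arguments prs_inj {M} p.
Arguments prs_map {M} p.
Arguments prs_ses {M} p.
Arguments prs_projective {M} p.
Arguments prs_trivial {M} p.

Lemma presentation_exists M : exists _ : presentation M, True.
Proof.
have [pM|npM] := pselect (projective M).
  have [|X [i ig]] := @ker_exists _ M M idfun; first by move=> z; exists z.
  by unshelve eexists; [exact: (Presentation ig pM)|].
have [X [P [i [g [ig pP]]]]] := enough_projectives M.
by unshelve eexists; [exact: (Presentation ig pP)|].
Qed.

(** A chosen presentation of [M]. *)
Definition presentation_of M : presentation M := sval (cid (presentation_exists M)).

(** The [n]-th syzygy of [M] with respect to the chosen presentations. *)
Fixpoint syzygy M n : lmodType R :=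
  if n is m.+1 then prs_ker (presentation_of (syzygy M m)) else M.

Lemma ext_syzygy n M V : ext n M V <-> ext1 (syzygy M n) V.
Proof.
have sh m k : ext m (syzygy M k.+1) V <-> ext m.+1 (syzygy M k) V.
  split=> [e|]; last first.
    by apply; [exact: prs_ses|exact: prs_projective].
  apply: (ext_shift (prs_ses _) _ e); exact: prs_projective.
have {sh} shn m : ext m (syzygy M n) V <-> ext (m + n) M V.
  by elim: n m => [|n IH] m; rewrite ?addn0 // sh IH addSnnS.
by rewrite -[X in ext X M V]add0n -shn.
Qed.

(** The resolution of [M] by the chosen presentations of its syzygies. *)
Section StandardResolution.
Variable M : lmodType R.

Definition std_obj n : lmodType R := prs_obj (presentation_of (syzygy M n)).
Definition std_cover n : {linear std_obj n -> syzygy M n} :=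
  prs_map (presentation_of (syzygy M n)).
Definition std_inj n : {linear syzygy M n.+1 -> std_obj n} :=
  prs_inj (presentation_of (syzygy M n)).

Lemma std_ses n : ses (std_inj n) (std_cover n).
Proof. exact: prs_ses. Qed.

Definition std_diff n : {linear std_obj n.+1 -> std_obj n} :=
  std_inj n \o std_cover n.+1.

Lemma std_diffE n x : std_diff n x = std_inj n (std_cover n.+1 x).
Proof. by []. Qed.

Lemma std_ker n x : std_cover n x = 0 <-> exists y, std_diff n y = x.
Proof.
have [_ _ ->] := std_ses n; split=> [[y <-]|[y <-]].
  by have [_ S _] := std_ses n.+1; have [z <-] := S y; exists z.
by exists (std_cover n.+1 y).
Qed.

Lemma std_exact n x : std_diff n x = 0 <-> exists y, std_diff n.+1 y = x.
Proof.
rewrite -std_ker std_diffE; have [iI _ _] := std_ses n.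
by split=> [x0|->]; [apply: iI|]; rewrite linear0.
Qed.

Definition std_resolution : proj_resolution M :=
  ProjResolution (fun n => prs_projective (presentation_of (syzygy M n)))
    (fun z => ses_surj z (std_ses 0)) (@std_ker 0) std_exact.

Lemma std_vanishes n : projective (syzygy M n) -> vanishes_above std_resolution n.
Proof.
move=> pn.
have z m : (n <= m)%N -> projective (syzygy M m) /\ forall x : syzygy M m.+1, x = 0.
  move=> /subnKC <-; elim: (m - n)%N => [|k [pk zk]].
    by rewrite addn0; split=> //; apply: ses_trivial (std_ses n) _; exact: prs_trivial.
  rewrite addnS; have p1 := trivial_projective zk; split=> //.
  by apply: ses_trivial (std_ses _) _; exact: prs_trivial.
case=> // i; rewrite ltnS => /z[_ zi] x.
apply: (prs_trivial (presentation_of (syzygy M i.+1)) (trivial_projective zi)).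
exact: zi.
Qed.

End StandardResolution.

Lemma pd_leP M n : (pd M <= (Posz n)%:E)%E <-> pdle n M.
Proof.
rewrite least_leP; split=> [[m mn [P vP]]|pM].
  exact: pdle_leq mn (resolution_pdle vP).
exists n => //; exists (std_resolution M); apply: std_vanishes.
by apply: ext1_projective => V; apply/ext_syzygy; exact: pM.
Qed.

Lemma Ext_eq0_ext M V n : Ext_eq0 M V n.+1 -> ext n M V.
Proof.
move=> /(_ (std_resolution M)) ext0; apply/ext_syzygy.
apply: (ext1_presentation (std_ses M n)) => [|h]; first exact: prs_projective.
have [x|g gE] := ext0 (h \o std_cover M n.+1).
  rewrite -[pr_diff _ _]/(std_diff M n.+1) /= (_ : std_cover M n.+1 _ = 0) ?linear0 //.
  by apply/std_ker; exists x.
exists g => x; have [_ S _] := std_ses M n.+1; have [y <-] := S x.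
exact: esym (gE y).
Qed.

Lemma inj_resolution_ext n V (I : inj_resolution V) :
  vanishes_above I n -> forall M, ext n M V.
Proof.
move=> vI.
have im m j K (i : {linear K -> I j.+1}) (q : {linear I j -> K}) :
    injective i -> (forall k, exists x, q x = k) ->
    (forall x, i (q x) = ir_diff I j x) ->
    vanishes_above I (j + m).+1 -> forall M, ext m M K.
  elim: m j K i q => [|m IH] j K i q iI qS qE vj M.
    have iS x : exists k, i k = x.
      have /ir_exact[y <-] : ir_diff I j.+1 x = 0 by apply: vj; rewrite addn0.
      by exists (q y); rewrite qE.
    have i0 k : i k = 0 -> k = 0 by move=> ik; apply: iI; rewrite linear0.
    have [i' [i'i ii']] := bij_retract i0 iS.
    apply: (ext_retract2 i'i); apply: injective_ext1; exact: ir_injective.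
  have [L [o [c [oI cS cE]]]] := image_exists (ir_diff I j.+1).
  have ic : ses i c.
    split=> // x; split=> [cx|[k <-]].
      have /ir_exact[y <-] : ir_diff I j.+1 x = 0 by rewrite -cE cx linear0.
      by exists (q y); rewrite qE.
    apply: oI; have [y <-] := qS k.
    by rewrite linear0 cE qE; apply/ir_exact; exists y.
  apply: (ext_shift2 ic (@ir_injective _ _ I _)).
  by apply: (IH j.+1 L o c) => //; rewrite addSnnS.
have [K [i [q [iI qS qE]]]] := image_exists (ir_diff I 0).
have iP : ses (ir_aug I) q.
  split=> //; first exact: ir_aug_inj.
  move=> y; split=> [qy|[k <-]].
    by apply/ir_exact0; rewrite -qE qy linear0.
  by apply: iI; rewrite linear0 qE; apply/ir_exact0; exists k.
case: n vI => [|n] vI M.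
  have aS x : exists y, ir_aug I y = x by apply/ir_exact0; exact: vI.
  have a0 x : ir_aug I x = 0 -> x = 0.
    by move=> ax; apply: (@ir_aug_inj _ _ I); rewrite linear0.
  have [b [ba ab]] := bij_retract a0 aS.
  apply: (ext_retract2 ba); apply: injective_ext1; exact: ir_injective.
apply: (ext_shift2 iP (@ir_injective _ _ I _)).
exact: (im n 0%N K i q).
Qed.

Lemma ext_all_leq n m V : (forall M, ext n M V) -> (n <= m)%N -> forall M, ext m M V.
Proof.
move=> eV /subnKC <-; elim: (m - n)%N => [|k IH] M; first by rewrite addn0.
by rewrite addnS => X P i g _ _; exact: IH.
Qed.

Lemma inj_dim_ext n V M : (inj_dim V <= (Posz n)%:E)%E -> ext n M V.
Proof.
move=> /least_leP[m mn [I vI]].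
exact: (ext_all_leq (inj_resolution_ext vI) mn).
Qed.

End Dimension.

Lemma gldim_leP (R : pzRingType) n :
  (gldim R <= (Posz n)%:E)%E <-> forall M : lmodType R^c, pdle n M.
Proof.
rewrite least_leP; split=> [[m mn pM] M|pM].
  by apply: pdle_leq mn _; apply/pd_leP.
by exists n => // M; apply/pd_leP.
Qed.

(** * Restriction of modules to a corner ring *)

Section CornerModules.
Variables (A : pzRingType) (f : A) (ff : f * f = f).
Notation Gamma := (corner ff).

Section CornerModule.
Variable M : lmodType A^c.

(** The elements [x] of [M] with [x f = x], that is, the elements of [M f]. *)
Definition corner_mod_pred (_ : f * f = f) : {pred M} :=
  fun x => (f : A^c) *: x == x.

(** [M f], a right module over the corner ring [f A f]. The proof that [f] is
    idempotent is part of the type, like in [corner ff]. *)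
Definition cmod : Type := {x : M | x \in corner_mod_pred ff}.

Lemma corner_mod_predP : zmod_closed (corner_mod_pred ff).
Proof.
split=> [|x y]; first by apply/eqP; rewrite scaler0.
by move=> /eqP xf /eqP yf; apply/eqP; rewrite scalerBr xf yf.
Qed.
HB.instance Definition _ :=
  GRing.isZmodClosed.Build M (corner_mod_pred ff) corner_mod_predP.
HB.instance Definition _ := SubChoice.on cmod.
HB.instance Definition _ := [SubChoice_isSubZmodule of cmod by <:].

Lemma cmodK (x : cmod) : (f : A^c) *: val x = val x.
Proof. by case: x => x /= /eqP. Qed.

Lemma scaleffK (x : M) : (f : A^c) *: ((f : A^c) *: x) = (f : A^c) *: x.
Proof. by rewrite scalerA; congr (_ *: _); exact: ff. Qed.

Fact cproj_in (x : M) : (f : A^c) *: x \in corner_mod_pred ff.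
Proof. by apply/eqP; exact: scaleffK. Qed.

(** [cproj x] is [x f], as an element of [M f]. *)
Definition cproj (x : M) : cmod := Sub ((f : A^c) *: x) (cproj_in x).

Lemma val_cproj x : val (cproj x) = (f : A^c) *: x.
Proof. by []. Qed.

Lemma cprojK (x : cmod) : cproj (val x) = x.
Proof. by apply: val_inj; exact: cmodK. Qed.

Lemma cprojD x y : cproj (x + y) = cproj x + cproj y.
Proof. by apply: val_inj; rewrite /= scalerDr. Qed.

Lemma cproj0 : cproj 0 = 0.
Proof. by apply: val_inj; rewrite /= scaler0. Qed.

Fact cscale_in (c : Gamma^c) (x : cmod) :
  (val (c : Gamma) : A^c) *: val x \in corner_mod_pred ff.
Proof.
apply/eqP; rewrite scalerA; congr (_ *: _).
exact: (corner_val (c : Gamma)).2.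
Qed.

(** The action of the corner ring on [M f], the restriction of that of [A]. *)
Definition cscale (c : Gamma^c) (x : cmod) : cmod :=
  Sub ((val (c : Gamma) : A^c) *: val x) (cscale_in c x).

Fact cscaleA a b x : cscale a (cscale b x) = cscale (a * b) x.
Proof. by apply: val_inj; rewrite /= scalerA. Qed.
Fact cscale1 : left_id 1 cscale.
Proof. by move=> x; apply: val_inj; exact: cmodK. Qed.
Fact cscaleDr : right_distributive cscale +%R.
Proof. by move=> a x y; apply: val_inj; rewrite /= scalerDr. Qed.
Fact cscaleDl x : {morph cscale^~ x : a b / a + b}.
Proof. by move=> a b; apply: val_inj; rewrite /= -scalerDl. Qed.
HB.instance Definition _ := GRing.Zmodule_isLmodule.Build Gamma^c cmod
  cscaleA cscale1 cscaleDr cscaleDl.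

Lemma val_cscale (c : Gamma^c) (x : cmod) :
  val (c *: x) = (val (c : Gamma) : A^c) *: val x.
Proof. by []. Qed.

Fact corner_of_in (a : A) : f * a * f \in corner_pred ff.
Proof. by apply/asboolP; exists a. Qed.

(** [f a f], as an element of the corner ring. *)
Definition corner_of (a : A) : Gamma := Sub (f * a * f) (corner_of_in a).

Lemma cproj_scale (a : A) (x : cmod) :
  cproj ((a : A^c) *: val x) = (corner_of a : Gamma^c) *: x.
Proof.
apply: val_inj; rewrite val_cscale val_cproj -{1}[val x]cmodK !scalerA.
by congr (_ *: _); rewrite /= /GRing.mul /= mulrA.
Qed.

End CornerModule.

Implicit Types (M N K Q W V X : lmodType A^c) (I : choiceType).

Lemma cmap_in M N (g : {linear M -> N}) (x : cmod M) :
  g (val x) \in corner_mod_pred ff.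
Proof. by apply/eqP; rewrite -linearZ /= cmodK. Qed.

Definition cmap_fun M N (g : {linear M -> N}) (x : cmod M) : cmod N :=
  Sub (g (val x)) (cmap_in g x).

Lemma cmap_linear M N (g : {linear M -> N}) : linear (cmap_fun g).
Proof. by move=> a x y; apply: val_inj; rewrite /= linearP. Qed.

(** The restriction [M f -> N f] of a linear map. *)
Definition cmap M N (g : {linear M -> N}) : {linear cmod M -> cmod N} :=
  lin_fun (cmap_linear g).

Lemma val_cmap M N (g : {linear M -> N}) x : val (cmap g x) = g (val x).
Proof. by []. Qed.

Lemma cmap_ses X M N (i : {linear X -> M}) (g : {linear M -> N}) :
  ses i g -> ses (cmap i) (cmap g).
Proof.
move=> [iI gS ex]; split=> [x y /(congr1 val)|z|y].
- by rewrite !val_cmap => /iI /val_inj.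
- have [y yE] := gS (val z); exists (cproj y); apply: val_inj.
  by rewrite val_cmap val_cproj linearZ /= yE cmodK.
split=> [/(congr1 val) gy|[x <-]].
  have /ex[x xE] : g (val y) = 0 by rewrite -val_cmap gy.
  exists (cproj x); apply: val_inj.
  by rewrite val_cmap val_cproj linearZ /= xE cmodK.
by apply: val_inj; rewrite !val_cmap; apply/ex; exists (val x).
Qed.

(** The modules annihilated by [f]. *)
Definition null_mod V := forall v : V, (f : A^c) *: v = 0.

(** [trace_gen N]: the module [N] is generated by [N f]. *)
Definition trace_gen N := forall P : N -> Prop, sub_closed P ->
  (forall x, P ((f : A^c) *: x)) -> forall x, P x.

Lemma null_cmod V : null_mod V -> forall x : cmod V, x = 0.
Proof. by move=> V0 x; apply: val_inj; rewrite -cmodK V0. Qed.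

Lemma ker_sub_closed (R : pzRingType) (X Y : lmodType R) (h : {linear X -> Y}) :
  sub_closed (fun x => h x = 0).
Proof. by split=> [|a x y xE yE]; rewrite ?linear0 // linearP xE yE scaler0 addr0. Qed.

Lemma eq_sub_closed (R : pzRingType) (X Y : lmodType R) (h g : {linear X -> Y}) :
  sub_closed (fun x => h x = g x).
Proof. by split=> [|a x y xE yE]; rewrite ?linear0 // !linearP xE yE. Qed.

Lemma trace_gen_hom0 N V : trace_gen N -> null_mod V -> hom0 N V.
Proof.
move=> tN V0 h; apply: tN; first exact: ker_sub_closed.
by move=> x; rewrite linearZ /= V0.
Qed.

Lemma trace_gen_surj M N (g : {linear M -> N}) :
  (forall y, exists x, g x = y) -> trace_gen M -> trace_gen N.
Proof.
move=> gS tM P [P0 PD] Pf y; have [x <-] := gS y.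
apply: (tM (fun x => P (g x))) => [|{}x]; last by rewrite linearZ; exact: Pf.
by split=> [|a u v Pu Pv]; rewrite ?linear0 ?linearP //; exact: PD.
Qed.

(** A map to a module generated by its corner is surjective as soon as its
    image contains the corner. *)
Lemma trace_gen_cover M N (g : {linear M -> N}) : trace_gen N ->
  (forall y : cmod N, exists x, g x = val y) -> forall y, exists x, g x = y.
Proof.
move=> tN gS; apply: tN => [|y]; last exact: (gS (cproj y)).
split=> [|a x y [u <-] [v <-]]; first by exists 0; rewrite linear0.
by exists (a *: u + v); rewrite linearP.
Qed.

(** Every module is an extension of a module annihilated by [f] by the
    submodule generated by its corner. *)
Lemma trace_exists N : exists K W (i : {linear K -> N}) (p : {linear N -> W}),
  [/\ ses i p, trace_gen K & null_mod W].
Proof.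
pose T (x : N) := forall P : N -> Prop, sub_closed P ->
  (forall x, P ((f : A^c) *: x)) -> P x.
have Tf x : T ((f : A^c) *: x) by move=> P _; exact.
have Tc : sub_closed T.
  by split=> [P [P0 _] _|a x y Tx Ty P cP Pf]; [|apply: cP.2; [exact: Tx|exact: Ty]].
have [K [i [iI iP]]] := submodule_exists Tc.
have [W [p ip]] := coker_exists iI.
exists K, W, i, p; split=> // [P [P0 PD] Pf x|w].
  have /(_ (fun y => exists2 t, i t = y & P t))[||t /iI <- //] :
    T (i x) by apply/iP; exists x.
  - split=> [|a y z [t <- Pt] [u <- Pu]]; first by exists 0; rewrite ?linear0.
    by exists (a *: t + u); [rewrite linearP|exact: PD].
  - move=> y; have /iP[t tE] := Tf y; exists ((f : A^c) *: t); last exact: Pf.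
    by rewrite linearZ /= tE scaleffK.
have [_ pS pe] := ip; have [y <-] := pS w.
by rewrite -linearZ; apply/pe/iP.
Qed.

(** * The direct sums of copies of [f A] *)

(** The direct sum [Q] of copies of [f A] indexed by [I]. The elements [y i] are
    the generators of the summands: linear maps out of [Q] correspond to
    families of elements of the corner of the target, and [Q f] is the free
    module over the corner ring on the [y i]. *)
Lemma corner_free_exists I : exists Q (y : I -> cmod Q),
  [/\ projective Q, trace_gen Q,
      forall N (n : I -> cmod N), exists h : {linear Q -> N},
        forall i, h (val (y i)) = val (n i),
      forall (U : lmodType Gamma^c) (u : I -> U),
        exists h : {linear cmod Q -> U}, forall i, h (y i) = u i
    & forall P : cmod Q -> Prop, sub_closed P -> (forall i, P (y i)) ->
        forall x, P x].
Proof.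
have [|F [j [jI jP]]] := @submodule_exists A^c (A^c)^o (fun x => f * (x : A) = x).
  split=> [|a x y xE yE]; first exact: mulr0.
  by rewrite -[a *: x]/((x : A) * (a : A)) mulrDr mulrA xE yE.
have [p0 p0E] : exists p0 : F, j p0 = (f : A) by apply/jP; exact: ff.
have p0f : (f : A^c) *: p0 = p0.
  by apply: jI; rewrite linearZ /= p0E; exact: ff.
have genF x : exists a : A^c, x = a *: p0.
  exists (j x); apply: jI; rewrite linearZ /= p0E; apply/esym.
  by apply/jP; exists x.
have recF N (n : cmod N) : exists h : {linear F -> N}, h p0 = val n.
  have hL : linear (fun x => (j x : A^c) *: val n).
    by move=> a x y; rewrite linearP scalerDl scalerA.
  by have [h hE] := linearW hL; exists h; rewrite hE p0E cmodK.
have freeF (c : Gamma) : (val c : A^c) *: p0 = 0 -> c = 0.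
  move=> c0; apply: val_inj; rewrite -(corner_val c).1.
  by have := congr1 j c0; rewrite linearZ /= p0E linear0.
have pF : projective F.
  move=> U V g h gS; have [u uE] := gS (h p0).
  have [k kE] := recF U (cproj u); exists k => x; have [a ->] := genF x.
  by rewrite !linearZ /= kE val_cproj linearZ /= uE -linearZ /= p0f.
have [Q [d [c dc]]] := dsum_exists I F.
have yin i : d i p0 \in corner_mod_pred ff by apply/eqP; rewrite -linearZ /= p0f.
pose y i : cmod Q := Sub (d i p0) (yin i).
have yE i : val (y i) = d i p0 by [].
have projd i (a : A^c) : cproj (d i (a *: p0)) = (corner_of a : Gamma^c) *: y i.
  by rewrite -cproj_scale yE linearZ.
have genQ (P : cmod Q -> Prop) : sub_closed P -> (forall i, P (y i)) -> forall x, P x.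
  move=> [P0 PD] Py x; rewrite -[x]cprojK.
  apply: (dsum_ind dc (P := fun z => P (cproj z))) => [|u v Pu Pv|i m].
  - by rewrite cproj0.
  - by rewrite cprojD -[cproj u]scale1r; exact: PD.
  - have [a ->] := genF m; rewrite projd -[_ *: _]addr0; exact: PD.
(* [Q f] is identified with a direct sum of copies of [Gamma]. *)
have [D [dG [cG dcG]]] := dsum_exists I (Gamma^c^o : lmodType Gamma^c).
have hL i : linear (fun a : Gamma^c^o => (a : Gamma^c) *: y i).
  by move=> a u v; rewrite scalerDl scalerA.
have [th thE] := dsum_rec dcG (fun i => lin_fun (hL i)).
have th_coord i x : c i (val (th x)) = (val (cG i x : Gamma) : A^c) *: p0.
  apply: (dsum_ind dcG (P := fun x => c i (val (th x)) =
    (val (cG i x : Gamma) : A^c) *: p0)) => [|u v uE vE|k a].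
  - by rewrite !linear0 scale0r.
  - by rewrite !linearD /= uE vE -scalerDl.
  rewrite thE /lin_fun /= linearZ /=; have [->|ki] := eqVneq k i.
    by rewrite (dsumK dc) (dsumK dcG).
  by rewrite (dsumK0 dc) // (dsumK0 dcG) // scaler0 scale0r.
have th0 x : th x = 0 -> x = 0.
  move=> thx; apply: (dsum_eq0 dcG) => i; apply: freeF.
  by rewrite -th_coord thx linear0.
have thS x : exists z, th z = x.
  apply: (genQ (fun x => exists z, th z = x)) => [|i].
    split=> [|a u v [z <-] [w <-]]; first by exists 0; rewrite linear0.
    by exists (a *: z + w); rewrite linearP.
  by exists (dG i 1); rewrite thE; exact: scale1r.
have [th' [th'K _]] := bij_retract th0 thS.
exists Q, y; split=> //.
- exact: dsum_projective dc pF.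
- move=> P [P0 PD] Pf; apply: (dsum_ind dc) => // [u v Pu Pv|i m].
    by rewrite -[u]scale1r; exact: PD.
  have [a ->] := genF m; rewrite -p0f linearZ linearZ /= -[_ *: _]addr0.
  exact: PD.
- move=> N n; have /choice[k kE] i := recF N (n i).
  by have [h hE] := dsum_rec dc k; exists h => i; rewrite yE hE kE.
move=> U u.
have uL i : linear (fun a : Gamma^c^o => (a : Gamma^c) *: u i).
  by move=> a v w; rewrite scalerDl scalerA.
have [h hE] := dsum_rec dcG (fun i => lin_fun (uL i)).
exists (h \o th') => i /=.
have -> : y i = th (dG i 1) by rewrite thE; exact: esym (scale1r _).
by rewrite th'K hE; exact: scale1r.
Qed.

(** [q : Q -> M] maps [Q f] onto [M f], where [Q] is projective and generated by
    [Q f], the module [Q f] is projective, and linear maps from [Q f] to a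
    corner [N f] are restrictions of maps from [Q] to [N]. *)
Definition corner_cover Q M (q : {linear Q -> M}) :=
  [/\ projective Q, trace_gen Q, projective (cmod Q),
      forall x, exists y, cmap q y = x
    & forall N (h : {linear cmod Q -> cmod N}),
        exists g : {linear Q -> N}, forall y, cmap g y = h y].

Lemma corner_cover_exists M : exists Q (q : {linear Q -> M}), corner_cover q.
Proof.
have [Q [y [pQ tQ recQ recFQ genQ]]] := corner_free_exists (cmod M).
have [q qE] := recQ M id; exists Q, q; split=> //.
- move=> U V g h gS; have /choice[u uE] x := gS (h (y x)).
  have [k kE] := recFQ U u; exists k.
  apply: (genQ (fun x => (g \o k) x = h x)); first exact: eq_sub_closed.
  by move=> i; rewrite /= kE uE.
- by move=> x; exists (y x); apply: val_inj; rewrite val_cmap qE.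
move=> N h; have [g gE] := recQ N (fun i => h (y i)); exists g.
apply: (genQ (fun x => cmap g x = h x)); first exact: eq_sub_closed.
by move=> i; apply: val_inj; rewrite val_cmap gE.
Qed.

(** Every module over the corner ring is the corner of a module, up to
    isomorphism. *)
Lemma cmod_ess_surj (X : lmodType Gamma^c) :
  exists M (a : {linear X -> cmod M}) (b : {linear cmod M -> X}),
    forall x, b (a x) = x.
Proof.
have [Q [y [_ _ _ recFQ _]]] := corner_free_exists X.
have [ev evE] := recFQ X id.
(* The largest submodule of [Q] whose corner is the kernel of [ev]. *)
have [|M [p [pS pP]]] := @quotient_exists _ Q
    (fun u => forall a : A^c, ev (cproj (a *: u)) = 0).
  split=> [a|b u v uE vE a]; first by rewrite scaler0 cproj0 linear0.
  by rewrite scalerDr scalerA cprojD linearD uE vE addr0.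
have pz z : cmap p z = 0 <-> ev z = 0.
  split=> [/(congr1 val)|evz]; first rewrite val_cmap.
    by move=> /pP/(_ 1); rewrite scale1r cprojK.
  apply: val_inj; rewrite val_cmap; apply/pP => a.
  by rewrite cproj_scale linearZ /= evz scaler0.
have evS x : exists z, ev z = x by exists (y x).
have cpS x : exists z, cmap p z = x.
  have [z zE] := pS (val x); exists (cproj z); apply: val_inj.
  by rewrite val_cmap val_cproj linearZ /= zE cmodK.
have [z|b bE] := @lin_factor_surj _ _ _ _ (cmap p) ev cpS; first by move/pz.
have [z|a aE] := @lin_factor_surj _ _ _ _ ev (cmap p) evS; first by move/pz.
by exists M, a, b => x; have [z <-] := evS x; rewrite aE bE.
Qed.

(** * Projectivity *)

(** A section of the cover [Q f -> M f] lifts to an endomorphism of [Q] that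
    kills [K], because [K] is generated by [K f], and so gives a section of
    [q]. *)
Lemma cover_split K Q M (k : {linear K -> Q}) (q : {linear Q -> M}) :
  corner_cover q -> ses k q -> trace_gen K -> projective (cmod M) -> projective M.
Proof.
move=> [pQ tQ pFQ qS lift] kq tK pFM.
have [s sE] := pFM _ _ (cmap q) idfun qS.
have [g gE] := lift Q (s \o cmap q).
have gk x : g (k x) = 0.
  apply: (tK (fun x => g (k x) = 0)) => [|{}x]; first exact: (ker_sub_closed (g \o k)).
  rewrite -[_ *: x]/(val (cproj x)) -val_cmap -val_cmap gE /= .
  by rewrite (ses_comp0 _ (cmap_ses kq)) !linear0.
have [_ qS' qe] := kq.
have [y|h hE] := @lin_factor_surj _ _ _ _ q g qS'; first by move=> /qe[x <-].
have qh m : q (h m) = m.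
  apply: (trace_gen_surj qS' tQ (P := fun m => q (h m) = m)).
    exact: (eq_sub_closed (q \o h) idfun).
  move=> {}m; rewrite -val_cproj; have [z <-] := qS (cproj m).
  by rewrite val_cmap hE -!val_cmap gE; congr val; exact: sE.
by apply/pdle0; apply: (pdle_retract qh); apply/pdle0.
Qed.

End CornerModules.

(** * Modules annihilated by the radical *)

Section Semisimple.
Variables (A : pzRingType) (J : A -> Prop).
Implicit Types (D K S U V W X : lmodType A^c).

(** [I] is the membership predicate of a right ideal of [A]. *)
Definition right_ideal (I : A -> Prop) := @sub_closed A^c (A^c)^o I.

(** Semisimplicity of [A / J] as a right module, in terms of elements: a right
    ideal [I] containing [J] has modulo [J] a complement generated by an
    element [c] with [1 - c] in [I]. *)
Definition semisimple_quotient := forall I, right_ideal I ->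
  (forall x, J x -> I x) ->
  exists c, I (1 - c) /\ forall r, I (c * r) -> J (c * r).

(** The modules annihilated by [J]. *)
Definition J_null V := forall (v : V) x, J x -> (x : A^c) *: v = 0.

Hypothesis ssJ : semisimple_quotient.

(** Submodules of a module annihilated by [J] are direct summands. *)
Lemma J_null_retract V X (i : {linear X -> V}) : J_null V -> injective i ->
  exists r : {linear V -> X}, forall x, r (i x) = x.
Proof.
move=> VJ iI.
pose zL (L : set V) x := x = 0 \/ L x.
pose P (L : set V) := sub_closed (zL L) /\ forall x, L (i x) -> x = 0.
(* A maximal submodule [L] meeting [X] trivially. The zero is added to the sets
   so that the union of the empty chain is admitted. *)
have [F FP Ftot|L [[Lc Li] Lmax]] := @Zorn_bigcup V P.
  split=> [|x [B FB] Bx]; last by case: (FP B FB) => _ Bi; exact: Bi.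
  split=> [|a x y]; first by left.
  have inF B z : F B -> zL B z -> zL (\bigcup_(X in F) X)%classic z.
    by move=> FB [->|Bz]; [left|right; exists B].
  move=> [->|[B FB Bx]] [->|[C FC Cy]].
  - by left; rewrite scaler0 addr0.
  - by right; exists C => //; rewrite scaler0 add0r.
  - by apply: (inF B) => //; case: (FP B FB) => [[B0 BD] _]; apply: BD; [right|left].
  - have [BC|CB] := Ftot _ _ FB FC.
      apply: (inF C) => //; case: (FP C FC) => [[_ CD] _].
      by apply: CD; right=> //; exact: BC.
    apply: (inF B) => //; case: (FP B FB) => [[_ BD] _].
    by apply: BD; right=> //; exact: CB.
case: (Lc) => L0 LD.
have zLi x : zL L (i x) -> x = 0.
  by case=> [ix|/Li//]; apply: iI; rewrite linear0.
pose T v := exists x l, zL L l /\ v = i x + l.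
have Tc : sub_closed T.
  split=> [|a u v [x [l [Ll ->]]] [y [m [Lm ->]]]].
    by exists 0, 0; rewrite linear0 addr0.
  exists (a *: x + y), (a *: l + m); split; first exact: LD.
  by rewrite linearP scalerDr addrACA.
have TL v : zL L v -> T v by move=> Lv; exists 0, v; rewrite linear0 add0r.
have TD u v : T u -> T v -> T (u + v) by rewrite -{2}[u]scale1r; exact: Tc.2.
have TN u v : T (u + v) -> T v -> T u.
  by move=> uv Tv; have := Tc.2 (-1) _ _ Tv uv; rewrite scaleN1r addrC addrK.
have Tall v : T v.
  apply: contrapT => nTv.
  have [||c [c1 cJ]] := ssJ (I := fun a => T ((a : A^c) *: v)).
  - split=> [|a x y Tx Ty]; first by rewrite scale0r; exact: Tc.1.
    by rewrite scalerDl -scalerA; exact: Tc.2.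
  - by move=> x Jx; rewrite VJ //; exact: Tc.1.
  (* [w A] meets [X + L] trivially, so [L + w A] contradicts maximality. *)
  pose w := (c : A^c) *: v.
  have nTw : ~ T w.
    by move=> Tw; apply: nTv; have := TD _ _ c1 Tw; rewrite -scalerDl subrK scale1r.
  pose L2 x := exists r l, zL L l /\ x = l + r *: w.
  have L2c : sub_closed L2.
    split=> [|a u u' [r [l [Ll ->]]] [q [m [Lm ->]]]].
      by exists 0, 0; rewrite scale0r addr0.
    exists (a * r + q), (a *: l + m); split; first exact: LD.
    by rewrite scalerDr scalerDl -scalerA addrACA.
  have LL2 : (zL L `<=` L2)%classic by move=> x Lx; exists 0, x; rewrite scale0r addr0.
  have zL2 x : zL L2 x <-> L2 x.
    by split=> [[->|//]|]; [exact: L2c.1|right].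
  have zL2c : sub_closed (zL L2).
    by split=> [|a x y /zL2 hx /zL2 hy]; apply/zL2; [exact: L2c.1|exact: L2c.2].
  have L2w : L2 w by exists 1, 0; rewrite scale1r add0r.
  apply: (Lmax L2); last first.
    split=> // x [r [l [Ll xE]]]; apply: zLi.
    suff rw : r *: w = 0 by rewrite xE rw addr0.
    rewrite /w scalerA; apply: VJ; apply: cJ.
    rewrite -[c * r]/((r : A^c) * (c : A^c)) -scalerA.
    apply: (TN _ l); last exact: TL.
    by rewrite addrC -/w -xE; exists x, 0; rewrite addr0.
  split=> [x Lx|sub]; first by apply: LL2; right.
  by apply: nTw; apply: TL; right; exact: sub.
have /choice[r rE] v : exists x, zL L (v - i x).
  by have [x [l [Ll ->]]] := Tall v; exists x; rewrite addrC addKr.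
have runiq x v : zL L (v - i x) -> r v = x.
  move=> Lx; apply/eqP; rewrite -subr_eq0; apply/eqP/zLi.
  have := LD (-1) _ _ (rE v) Lx; rewrite scaleN1r opprB addrA subrK.
  by rewrite -linearB.
have rL : linear r.
  move=> a x y; apply: runiq; rewrite linearP opprD addrACA -scalerBr; exact: LD.
by have [h hE] := linearW rL; exists h => x; rewrite hE; apply: runiq; rewrite subrr; left.
Qed.

Lemma J_null_section V W (g : {linear V -> W}) : J_null V ->
  (forall w, exists v, g v = w) -> exists s : {linear W -> V}, forall w, g (s w) = w.
Proof.
move=> VJ gS; have [X [i ig]] := ker_exists gS.
have [iI _ ie] := ig; have [r rE] := J_null_retract VJ iI.
have [v|s sE] := @lin_factor_surj _ _ _ _ g (idfun \- (i \o r)) gS.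
  by move=> /ie[x <-]; rewrite /= rE subrr.
exists s => w; have [v <-] := gS w.
by rewrite sE /= linearB /= (ses_comp0 _ ig) subr0.
Qed.

(** * The modules annihilated by [1 - e] *)

Variables (e : A) (ee : e * e = e).
Notation f := (1 - e).
Notation null := (null_mod f).

Hypotheses (Jr : forall x a, J x -> J (x * a)) (Jl : forall x a, J x -> J (a * x)).
Hypothesis Jef : forall a, J (e * a * f).

(** On a module annihilated by [1 - e] the element [e] acts as the identity. *)
Lemma null_scale_e V : null V -> forall v : V, (e : A^c) *: v = v.
Proof.
move=> V0 v; have := V0 v; rewrite -[X in X *: v]/((1 : A^c) - (e : A^c)).
by rewrite scalerBl scale1r => /eqP; rewrite subr_eq0 => /eqP <-.
Qed.

(** [S], with [pi], is the quotient of [A] by the right ideal of the [a] with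
    [e a] in [J]; it is isomorphic to [e A / e J]. *)
Variables (S : lmodType A^c) (pi : {linear (A^c)^o -> S}).
Hypotheses (piS : forall s, exists a, pi a = s).
Hypothesis piP : forall a : A, pi a = 0 <-> J (e * a).

Lemma pi_scale (a b : A) : (b : A^c) *: pi a = pi (a * b).
Proof. by rewrite -linearZ. Qed.

Lemma top_J_null : J_null S.
Proof.
by move=> s x Jx; have [a <-] := piS s; rewrite pi_scale; apply/piP/Jl/Jl.
Qed.

Lemma top_null : null S.
Proof.
by move=> s; have [a <-] := piS s; rewrite pi_scale; apply/piP; rewrite mulrA.
Qed.

(** A cyclic module annihilated by [1 - e] and [J] is a quotient of [S]. *)
Lemma top_maps V (v : V) : null V -> J_null V ->
  exists h : {linear S -> V}, forall a : A, h (pi a) = (a : A^c) *: v.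
Proof.
move=> V0 VJ.
have hL : linear (fun a : (A^c)^o => (a : A^c) *: v).
  by move=> a x y; rewrite scalerDl scalerA.
have [a|h hE] := @lin_factor_surj _ _ _ _ pi (lin_fun hL) piS.
  move=> /piP Ja; change ((a : A^c) *: v = 0).
  by rewrite -(null_scale_e V0 v) scalerA; exact: VJ.
by exists h => a; rewrite hE.
Qed.

(** Modules annihilated by [1 - e] and [J] are separated by maps to [S]. *)
Lemma null_embed V (v : V) : null V -> J_null V -> v <> 0 ->
  exists h : {linear V -> S}, h v <> 0.
Proof.
move=> V0 VJ v0; have [h hE] := top_maps v V0 VJ.
have [K [i [q [iI qS qE]]]] := image_exists h.
have [s sE] := J_null_section top_J_null qS.
have [r rE] := J_null_retract VJ iI.
exists (s \o r) => /= srv; apply: v0.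
have vE : i (q (pi 1)) = v by rewrite qE hE scale1r.
by rewrite -vE -[q _]rE vE -[r v]sE srv !linear0.
Qed.

(** A form of Nakayama's lemma: if every right ideal containing [e J (1 - e)]
    and [e J J] contains [e J], then every right ideal containing [e J (1 - e)]
    contains [e J]. *)
Definition nakayama_property :=
  (forall M, right_ideal M -> (forall x, J x -> M (e * x * f)) ->
     (forall x y, J x -> J y -> M (e * x * y)) -> forall x, J x -> M (e * x)) ->
  forall T, right_ideal T -> (forall x, J x -> T (e * x * f)) ->
    forall x, J x -> T (e * x).

Hypotheses (J0 : J 0) (JD : forall x y, J x -> J y -> J (x + y)).

(** If Ext^1(S, S) = 0, then modules annihilated by [1 - e] are annihilated by
    [J]. *)
Lemma null_J_null V : nakayama_property -> ext1 S S -> null V -> J_null V.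
Proof.
move=> nak eSS V0 v x Jx; rewrite -(null_scale_e V0 v) scalerA.
apply: (nak _ (fun a => (a : A^c) *: v = 0)) Jx; last first.
- move=> y Jy; rewrite -[_ * f]/((f : A^c) * (e * y : A)) -scalerA; exact: V0.
- split=> [|a y z yE zE]; first exact: scale0r.
  by rewrite scalerDl -scalerA yE zE scaler0 addr0.
move=> M Mc Mf MJ y Jy; apply: contrapT => nM.
(* [N] is the image of [e J] in [A / M]; it has a nonzero map [h] to [S], which
   is extended to [A] by [g]. *)
have [|Y [j [jI jP]]] := @submodule_exists A^c (A^c)^o (fun y => J y /\ e * (y : A) = y).
  split=> [|a u w [Ju uE] [Jw wE]]; first by split; [exact: J0|exact: mulr0].
  rewrite -[a *: u]/((u : A) * (a : A)); split; first by apply: JD => //; exact: Jr.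
  by rewrite mulrDr mulrA uE wE.
have [|N [q [qS qP]]] := @quotient_exists _ Y (fun u => M (j u)).
  split=> [|a u w Mu Mw]; first by rewrite linear0; exact: Mc.1.
  by rewrite linearP; exact: Mc.2.
have jY u : J (j u) /\ e * (j u : A) = j u by apply/jP; exists u.
have N0 : null N.
  move=> n; have [u <-] := qS n; rewrite -linearZ; apply/qP; rewrite linearZ /=.
  by rewrite -[_ *: _]/((j u : A) * f) -(jY u).2; apply: Mf; case: (jY u).
have NJ : J_null N.
  move=> n z Jz; have [u <-] := qS n; rewrite -linearZ; apply/qP; rewrite linearZ /=.
  by rewrite -[_ *: _]/((j u : A) * z) -(jY u).2; apply: MJ => //; case: (jY u).
have eyJ : J (e * y) /\ e * (e * y) = e * y by split; [exact: Jl|rewrite mulrA ee].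
have [u uE] : exists u, j u = (e * y : A) by apply/jP.
have [h hu] : exists h : {linear N -> S}, h (q u) <> 0.
  by apply: null_embed => // /qP; rewrite uE.
have [K [i ip]] := ker_exists piS; have [iI _ ie] := ip.
have eL : linear (fun a : (A^c)^o => (e * (a : A) : A) : (A^c)^o).
  by move=> a b c; rewrite mulrDr mulrA.
have [t|k kE] := @lin_factor_inj _ _ _ _ j (lin_fun eL \o i) jI.
  apply/jP; rewrite /= /lin_fun; split; last by rewrite mulrA ee.
  by apply/piP; exact: (ses_comp0 t ip).
have [g gE] := eSS _ _ _ _ ip (h \o q \o k).
have /ie[t tE] : pi (e * y) = 0 by apply/piP; case: (eyJ) => _ ->; case: eyJ.
apply: hu; have -> : u = k t.
  by apply: jI; rewrite kE /= /lin_fun tE uE; case: eyJ.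
rewrite -[h _]/((h \o q \o k) t) -gE tE.
have -> : g (e * y : A) = (e * y : A^c) *: g 1.
  rewrite -linearZ /=; congr (g _); exact: esym (mul1r (e * y)).
exact/top_J_null/Jl.
Qed.

Hypothesis null_J : forall V, null V -> J_null V.

(** A module annihilated by [1 - e] is a direct summand of a direct sum of
    copies of [S]. *)
Lemma null_top_dsum W : null W ->
  exists D (d : W -> {linear S -> D}) (c : W -> {linear D -> S})
    (a : {linear W -> D}) (b : {linear D -> W}),
    is_dsum d c /\ forall w, b (a w) = w.
Proof.
move=> W0; have WJ := null_J W0.
have [D [d [c dc]]] := dsum_exists W S.
have /choice[h hE] (w : W) := top_maps w W0 WJ.
have [b bE] := dsum_rec dc h.
have DJ : J_null D.
  apply: null_J => x; apply: (dsum_ind dc (P := fun x => (f : A^c) *: x = 0)).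
  - exact: scaler0.
  - by move=> y z yE zE; rewrite scalerDr yE zE addr0.
  - by move=> w m; rewrite -linearZ /= top_null linear0.
have bS w : exists x, b x = w.
  by exists (d w (pi 1)); rewrite bE hE scale1r.
by have [a aE] := J_null_section DJ bS; exists D, d, c, a, b.
Qed.

(** A module annihilated by [1 - e] is a direct summand of a product of copies
    of [S]. *)
Lemma null_top_prod V : null V ->
  exists (I : Type) (a : {linear V -> fun_lmod I S}) (b : {linear fun_lmod I S -> V}),
    forall v, b (a v) = v.
Proof.
move=> V0; have VJ := null_J V0.
pose I : Type := {linear V -> S}.
have aL : linear (fun v => (fun h : I => h v) : fun_lmod I S).
  by move=> a u v; apply/funext => h; rewrite linearP.
have [a aE] := linearW aL.
have aI : injective a.
  apply: lin_inj => v av; apply: contrapT => v0.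
  have [h] := null_embed V0 VJ v0; apply.
  by have := aE v; rewrite av => /(congr1 (fun F : I -> S => F h)).
have FJ : J_null (fun_lmod I S).
  by apply: null_J => F; apply/funext => h; exact: top_null.
by have [b bE] := J_null_retract FJ aI; exists I, a, b.
Qed.

Lemma null_pdle n W : pdle n S -> null W -> pdle n W.
Proof.
move=> pS /null_top_dsum[D [d [c [a [b [dc ba]]]]]].
by apply: (pdle_retract ba) => V; exact: (ext_dsum dc).
Qed.

Lemma null_ext2 n M V : ext n M S -> null V -> ext n M V.
Proof.
move=> eS /null_top_prod[I [a [b ba]]].
by apply: (ext_retract2 ba); exact: ext_prod.
Qed.

Lemma null_ext n W V : ext n S S -> null W -> null V -> ext n W V.
Proof.
move=> eS /null_top_dsum[D [d [c [a [b [dc ba]]]]]] V0.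
by apply: null_ext2 V0; apply: (ext_retract ba); exact: (ext_dsum dc).
Qed.

End Semisimple.

(** * Comparison of the projective dimensions over A and over the corner *)

Section Comparison.
Variables (A : pzRingType) (f : A) (ff : f * f = f).
Notation Gamma := (corner ff).
Notation null := (null_mod f).
Notation tgen := (trace_gen f).
Implicit Types (K L M N P Q T V W : lmodType A^c).

Hypothesis ext_null : forall n W V, null W -> null V -> ext n W V.

(** A surjection with null kernel induces a bijection of corners. *)
Lemma null_kernel_bij K M N (i : {linear K -> M}) (g : {linear M -> N}) :
  ses i g -> null K ->
  exists h : {linear cmod ff N -> cmod ff M},
    (forall x, h (cmap ff g x) = x) /\ forall y, cmap ff g (h y) = y.
Proof.
move=> ig K0; have [_ gS ge] := cmap_ses ff ig.
by apply: bij_retract => // x /ge[y <-]; rewrite (null_cmod K0 y) linear0.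
Qed.

(** An injection with null cokernel induces a bijection of corners. *)
Lemma null_coker_bij K M N (i : {linear K -> M}) (g : {linear M -> N}) :
  ses i g -> null N ->
  exists h : {linear cmod ff M -> cmod ff K},
    (forall x, h (cmap ff i x) = x) /\ forall y, cmap ff i (h y) = y.
Proof.
move=> ig N0; have [iI gS ge] := cmap_ses ff ig.
apply: bij_retract => [x ix|y]; first by apply: iI; rewrite ix linear0.
by apply/ge; exact: null_cmod.
Qed.

(** [N] is generated by [N f], and Ext^i(N, V) = 0 for all null [V] and all
    [i > 0]. *)
Definition good N := tgen N /\ forall n V, null V -> ext n N V.

Lemma cover_ses N Q (q : {linear Q -> N}) : tgen N -> corner_cover ff q ->
  exists K (k : {linear K -> Q}), ses k q.
Proof.
move=> tN [_ _ _ qS _]; apply: ker_exists; apply: (trace_gen_cover (ff := ff) tN) => y.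
by have [x <-] := qS y; exists (val x).
Qed.

Lemma good_syzygy N Q K (k : {linear K -> Q}) (q : {linear Q -> N}) :
  corner_cover ff q -> ses k q -> good N -> good K.
Proof.
move=> [pQ tQ _ _ _] kq [tN eN]; split=> [|n V V0]; last first.
  exact: (eN n.+1 V V0) kq pQ.
have [K' [W [i [p [ip tK' W0]]]]] := trace_exists ff K.
have [h hE] := eN 0%N W W0 _ _ _ _ kq p.
apply: trace_gen_surj tK'; case: ip => _ _ ie x; apply/ie.
by rewrite -hE (trace_gen_hom0 tQ W0 h).
Qed.

(** For a good module the two projective dimensions agree. *)

Lemma good_pdle_corner m N : good N -> pdle m N -> pdle m (cmod ff N).
Proof.
elim: m N => [|m IH] N gN pN.
  all: have [Q [q cq]] := corner_cover_exists ff N.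
  all: have [K [k kq]] := cover_ses gN.1 cq; case: (cq) => pQ _ pFQ _ _.
  have /pdle0 pN' := pN; have [_ qS _] := kq; have [s sE] := pN' _ _ q idfun qS.
  apply: (@pdle_retract _ _ _ (cmod ff Q) (cmap ff s) (cmap ff q)).
    by move=> x; apply: val_inj; rewrite !val_cmap sE.
  exact: projective_pdle.
move=> V; apply: (ext_shift (cmap_ses ff kq) pFQ).
by apply: IH; [exact: good_syzygy cq kq gN|move=> U; exact: pN kq pQ].
Qed.

Lemma corner_pdle_good m N : good N -> pdle m (cmod ff N) -> pdle m N.
Proof.
elim: m N => [|m IH] N gN pN.
  all: have [Q [q cq]] := corner_cover_exists ff N.
  all: have [K [k kq]] := cover_ses gN.1 cq; case: (cq) => pQ _ pFQ _ _.
  all: have gK := good_syzygy cq kq gN.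
  by apply/pdle0; apply: (cover_split cq kq gK.1); apply/pdle0.
move=> V; apply: (ext_shift kq pQ); apply: IH => // U.
exact: pN (cmap_ses ff kq) pFQ.
Qed.

(** If Ext^i(N, V) = 0 for all null [V] and [i > 0], then [N f A] is good. *)
Lemma trace_good K N W (i : {linear K -> N}) (p : {linear N -> W}) :
  ses i p -> tgen K -> null W -> (forall n V, null V -> ext n N V) -> good K.
Proof.
move=> ip tK W0 eN; split=> // n V V0.
have [_ left _] := @ext_long_exact _ n _ _ _ V _ _ ip.
by apply: left; [exact: eN|exact: ext_null].
Qed.

(** * Bounding the dimension over the corner *)

Section CornerBound.
Variable p : nat.
Hypothesis pd_null : forall W, null W -> pdle p W.

(** The hypothesis on [M] says that Ext^i(M, V) = 0 for all [i > j] and all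
    null [V]. *)
Lemma pdle_corner j M g :
  (forall i V, (j <= i)%N -> null V -> ext i M V) -> pdle g M -> (j <= g)%N ->
  pdle (maxn g (j + p.-1)) (cmod ff M).
Proof.
(* For [j = 0] the module [N f A] is good. *)
have base N d : (forall i V, null V -> ext i N V) -> pdle d N ->
    pdle (maxn d p.-1) (cmod ff N).
  move=> eN pN; have [K [W [i [q [iq tK W0]]]]] := trace_exists ff N.
  have gK := trace_good iq tK W0 eN; have [h [_ hE]] := null_coker_bij iq W0.
  apply: (pdle_retract hE); apply: good_pdle_corner gK _.
  have [_ left _] := pdle_ses (maxn d p.-1) iq; apply: left.
    by apply: pdle_leq pN; exact: leq_maxl.
  apply: pdle_leq (pd_null W0); apply: (leq_trans (leqSpred p)).
  by rewrite ltnS leq_maxr.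
elim: j M g => [|j IH] M g eM pM jg; first by apply: base => // i V; exact: eM.
case: g pM jg => // g pM jg.
have [K [P [i [q [iq pP]]]]] := enough_projectives M.
rewrite addSn maxnSS.
have [_ _ right] := pdle_ses (maxn g (j + p.-1)) (cmap_ses ff iq); apply: right.
  apply: IH => // [n V jn V0|V]; first by apply: (eM n.+1 V _ V0 _ _ _ _ iq pP).
  exact: pM iq pP.
have bP : pdle (maxn 0 p.-1) (cmod ff P).
  by apply: base => [n V _|]; [|apply/pdle0]; [exact: projective_ext|].
apply: pdle_leq bP; rewrite max0n; apply: (leq_trans (leq_addl j _)).
exact: (leq_trans (leq_maxr g _)).
Qed.

End CornerBound.

(** * Bounding the dimension over A *)

Section RingBound.
Variable n : nat.
Hypothesis pd_corner : forall X : lmodType Gamma^c, pdle n X.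

(** A null module [W] is a direct summand of [B = P / P f A], where [P] is
    projective and maps onto [W], and [P f A] is good. *)
Lemma null_pdle_corner W : null W -> pdle n.+1 W.
Proof.
move=> W0; have [O [P [o [g [og pP]]]]] := enough_projectives W.
have [K [B [i [p [ip tK B0]]]]] := trace_exists ff P.
have pB : pdle n.+1 B.
  move=> V; apply: (ext_shift ip pP); apply: corner_pdle_good => //.
  by apply: (trace_good ip tK B0) => m U _; exact: projective_ext.
have [_ gS _] := og; have [_ pS pe] := ip.
have [y|h hE] := @lin_factor_surj _ _ _ _ p g pS.
  by move=> /pe[x <-]; exact: (trace_gen_hom0 tK W0 (g \o i)).
have hS w : exists b, h b = w by have [y <-] := gS w; exists (p y).
have [L [j jh]] := ker_exists hS; have [jI _ je] := jh.
have L0 : null L by move=> l; apply: jI; rewrite linearZ /= B0 linear0.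
have [r rE] := ext_null 0%N W0 L0 _ _ _ _ jh idfun.
have [b|s sE] := @lin_factor_surj _ _ _ _ h (idfun \- (j \o r)) hS.
  by move=> /je[l <-]; rewrite /= rE subrr.
apply: (pdle_retract (a := s) (b := h)) pB => w; have [b <-] := hS w.
by rewrite sE /= linearB /= (ses_comp0 _ jh) subr0.
Qed.

(** Up to null modules, [M] is [T = M f A], which is covered by [Q]. If [M f] is
    projective, dividing [Q] by [K f A], where [K] is the kernel of the cover,
    gives a projective module [M'] mapping onto [T] with null kernel. *)
Lemma pdle_of_corner m M : pdle m (cmod ff M) -> pdle (m + n.+2) M.
Proof.
elim: m M => [|m IH] M pM.
  all: have [T [W [i [p [ip tT W0]]]]] := trace_exists ff M.
  all: have [h [hE _]] := null_coker_bij ip W0.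
  all: have pFT := pdle_retract hE pM.
  all: have [Q [q cq]] := corner_cover_exists ff T.
  all: have [K [k kq]] := cover_ses tT cq; case: (cq) => pQ tQ pFQ qS lift.
  all: have pW : pdle n.+2 W by exact/pdleS/null_pdle_corner.
  all: have [mid _ _] := pdle_ses n.+2 ip.
  rewrite add0n; apply: mid => //.
  have [K' [L [j [l [jl tK' L0]]]]] := trace_exists ff K.
  have [jI _ le] := jl; have [kI qS' ke] := kq.
  have kjI : injective (k \o j) by move=> x y /kI /jI.
  have [M' [q' kq']] := coker_exists kjI; have [_ q'S q'e] := kq'.
  have [y|t tE] := @lin_factor_surj _ _ _ _ q' q q'S.
    by move=> /q'e[x <-]; exact: (ses_comp0 (j x) kq).
  have tS y : exists x, t x = y by have [x <-] := qS' y; exists (q' x).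
  have [N [s st]] := ker_exists tS; have [sI _ se] := st.
  have N0 : null N.
    move=> x; apply: sI; rewrite linear0 linearZ /=.
    have [y yE] := q'S (s x); rewrite -yE -linearZ; apply/q'e.
    have /ke[z zE] : q y = 0 by rewrite -tE yE; exact: ses_comp0 st.
    have /le[u uE] : l ((f : A^c) *: z) = 0 by rewrite linearZ /= L0.
    by exists u; rewrite /= uE linearZ /= zE.
  have cq' : corner_cover ff q'.
    by split=> // x; have [_ S' _] := cmap_ses ff kq'; exact: S'.
  have [t' [t'E _]] := null_kernel_bij st N0.
  have pM' : projective M'.
    apply: (cover_split cq' kq' tK'); apply/pdle0.
    exact: (pdle_retract t'E).
  by move=> V; apply: (ext_shift st pM'); exact: null_pdle_corner.
have [mid' _ _] := pdle_ses (m.+1 + n.+2) ip; apply: mid'; last first.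
  by apply: pdle_leq pW; exact: leq_addl.
rewrite addSn => V; apply: (ext_shift kq pQ); apply: IH => U.
exact: pFT (cmap_ses ff kq) pFQ.
Qed.

End RingBound.

End Comparison.

(** * The semiperfect basic case *)

(** In a Noetherian module every nonempty set of submodules has a maximal
    element. *)
Lemma noetherian_max (R : pzRingType) (M : lmodType R) : noetherian_mod M ->
  forall (Q : submodClosed M -> Prop) N0, Q N0 ->
  exists2 N, Q N & forall L : submodClosed M,
    Q L -> {subset N <= L} -> {subset L <= N}.
Proof.
move=> noeth Q N0 QN0; apply: contrapT => nomax.
have step (N : {N | Q N}) : exists L : {N | Q N},
    {subset sval N <= sval L} /\ ~ {subset sval L <= sval N}.
  apply: contrapT => nex; apply: nomax; exists (sval N) => [|L QL NL].
    exact: (svalP N).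
  by apply: contrapT => nLN; apply: nex; exists (exist _ L QL).
have /choice[next nextP] := step.
pose chain i := iter i next (exist _ N0 QN0).
have [i|n nP] := noeth (fun i => sval (chain i)).
  by case: (nextP (chain i)).
by case: (nextP (chain n)) => _; apply; exact: (nP n.+1).
Qed.

Section RightIdeals.
Variable A : pzRingType.
Variables (I : A -> Prop) (rI : right_ideal I).

Lemma right_ideal0 : I 0. Proof. exact: rI.1. Qed.

Lemma right_idealD x y : I x -> I y -> I (x + y).
Proof. by move=> Ix Iy; have := rI.2 1 x y Ix Iy; rewrite scale1r. Qed.

Lemma right_idealM x a : I x -> I (x * a).
Proof. by move=> Ix; have := rI.2 a x 0 Ix rI.1; rewrite addr0. Qed.

Lemma right_idealB x y : I x -> I y -> I (x - y).
Proof.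
move=> Ix Iy; apply: right_idealD => //; rewrite -mulrN1; exact: right_idealM.
Qed.

Lemma right_ideal_sum n (F : 'I_n -> A) : (forall i, I (F i)) -> I (\sum_i F i).
Proof.
move=> IF; elim/big_ind: _ => //; [exact: right_ideal0|exact: right_idealD].
Qed.

End RightIdeals.

Section Semiperfect.
Variable A : nzRingType.
Notation Jac := (fun x : A => (x : (A^c)^o) \in @jacobson A).
Notation pr := (\pi_(radquo A)).

Lemma pr_eq0 (x : A) : pr x = 0 <-> Jac x.
Proof.
have -> : 0 = pr (0 : A) by exact: esym (raddf0 (\pi_(Quotient.quot _))).
by rewrite (pi_radquoP x 0) subr0.
Qed.

Lemma semiperfect_semisimple : semiperfect A -> semisimple_quotient Jac.
Proof.
move=> [ss _] I rI JI.
have [|N NP] := @prop_submodP _ ((radquo A)^c)^o (fun u => exists2 x, I x & u = pr x).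
  split=> [|a u v [x Ix ->] [y Iy ->]].
    by exists 0; [exact: (right_ideal0 rI)|apply/esym/pr_eq0/rpred0].
  have [b ->] := radquoW (a : radquo A); exists (x * b + y).
    by apply: (right_idealD rI) => //; exact: (right_idealM rI).
  by rewrite pi_radquoD (pi_radquoM x b).
have [L [NL0 NLT]] := ss N.
have [y [z [/NP[x Ix ->] zL oneE]]] := NLT (1 : radquo A).
have [c zE] := radquoW z; rewrite zE in zL oneE.
exists c; split=> [|r Icr].
  rewrite -[1 - c](subrK x); apply: (right_idealD rI) => //; apply: JI.
  have /pi_radquoP : pr 1 = pr (x + c) by rewrite pi_radquoD -oneE.
  by rewrite opprD addrA addrAC.
apply/pr_eq0; apply: NL0; first by apply/NP; exists (c * r).
rewrite (pi_radquoM c r); exact: (@rpredZ _ _ L (pr r : (radquo A)^c) _ zL).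
Qed.

(** A right ideal [N] maximal among those containing [T] but not [e J] contains
    [e J J], since [(e J + N) / N] is simple. *)
Lemma semiperfect_nakayama (e : A) :
  noetherian_mod (A^c)^o -> nakayama_property Jac e.
Proof.
move=> noeth H T rT Tf x Jx; apply: contrapT => nTx.
have [T' TE] := prop_submodP rT.
pose Q (N : submodClosed (A^c)^o) := {subset T' <= N} /\
  exists2 x : A, Jac x & (e * x : A) \notin N.
have [|N [TN [y Jy yN]] Nmax] := noetherian_max noeth (Q := Q) (N0 := T').
  by split=> //; exists x => //; apply/negP => /TE.
have Ncyc (m : A) : m \notin N -> forall z, Jac z -> e * z \in add_cyclic N m.
  move=> mN z Jz; apply: contrapT => nz; case/negP: mN.
  have sub : {subset N <= add_cyclic N m}.
    by move=> n nN; apply/asboolP; exists n, 0; rewrite mulr0 addr0.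
  apply: (Nmax (GRing.SubmodClosed.clone _ _ (add_cyclic N m) _)) => //.
    split; first by move=> t /TN; exact: sub.
    by exists z => //; exact/negP.
  by apply/asboolP; exists 0, 1; rewrite mulr1 add0r; split=> //; exact: (@rpred0 _ N).
case/negP: yN; apply: (H (fun a => (a : (A^c)^o) \in N)) => //.
- split=> [|a u v]; first exact: (@rpred0 _ N).
  by move=> uN vN; exact: (rpredD (rpredZ a uN) vN).
- by move=> z Jz; apply/TN/TE/Tf.
move=> u v Ju Jv; have [uN|uN] := boolP ((e * u : A) \in N).
  exact: (@rpredZ _ _ N (v : A^c) _ uN).
have maxC : maximal_submod (colon N (e * u)).
  split=> [|L subL]; first by exists 1; rewrite unfold_in /= mulr1.
  have [[b bL bN]|nob] := pselect (exists2 b : A, b \in L & e * u * b \notin N).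
    right=> z; have /asboolP[n [r [nN uE]]] := Ncyc _ bN u Ju.
    have brL : b * r \in L by exact: (@rpredZ _ _ L (r : A^c) b).
    have : 1 - b * r \in L.
      apply: subL; change (e * u * (1 - b * r) \in N).
      by rewrite mulrBr mulr1 mulrA {1}uE addrK.
    move=> /(fun h => rpredD h brL); rewrite subrK => oneL.
    by rewrite -[z](mul1r (z : A)); exact: (@rpredZ _ _ L (z : A^c) (1 : A)).
  left=> b bL; apply: contrapT => /negP bN.
  by apply: nob; exists b.
by have /asboolP/(_ _ maxC) := Jv.
Qed.

End Semiperfect.

(** The idempotents of a product of division rings are central, so
    [e a (1 - e)] vanishes in [A / J]. *)
Lemma basic_corner (k : fieldType) (A : algType k) (e a : A) : basic A ->
  e * e = e -> ((e * a * (1 - e) : A) : (A^c)^o) \in @jacobson A.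
Proof.
move=> [n [D [p [unitD _ /bij_inj pI]]]] ee; apply/pr_eq0; apply: pI.
apply: functional_extensionality_dep => i /=; rewrite rmorph0.
have pM (x y : A) : p i (\pi_(radquo A) (x * y)) =
    p i (\pi_(radquo A) x) * p i (\pi_(radquo A) y).
  by rewrite (pi_radquoM x y) -rmorphM.
rewrite !pM; set x := p i (\pi_(radquo A) e).
have xx : x * x = x by rewrite -pM ee.
have -> : p i (\pi_(radquo A) (1 - e)) = 1 - x.
  apply/eqP; rewrite -subr_eq opprK; apply/eqP.
  by rewrite -[RHS](rmorph1 (p i)) -rmorphD -pi_radquoD subrK.
have [->|x0] := eqVneq x 0; first by rewrite !mul0r.
have -> : x = 1 by rewrite -[LHS](mulKr (unitD i x x0)) xx mulVr // unitD.
by rewrite subrr mulr0.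
Qed.

(** * The positively graded case *)

Section Graded.
Variables (k : fieldType) (A : algType k) (G : pos_grading A).
Notation J := (fun x : A => (x : (A^c)^o) \in graded_rad G).

Lemma gr_0 i : 0 \in G i.
Proof. exact: (gr_submod G i).1. Qed.

Lemma gr_D i x y : x \in G i -> y \in G i -> x + y \in G i.
Proof. by move=> xG yG; have := (gr_submod G i).2 1 x y xG yG; rewrite scale1r. Qed.

Lemma gr_N i x : x \in G i -> - x \in G i.
Proof.
move=> xG; have := (gr_submod G i).2 (-1) x 0 xG (gr_0 i).
by rewrite addr0 scaleN1r.
Qed.

Lemma gr_M i j x y : x \in G i -> y \in G j -> x * y \in G (i + j)%N.
Proof.
move=> xG yG; apply/gr_mul; exists 1%N, (fun=> x), (fun=> y).
by split=> //; rewrite big_ord1.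
Qed.

(** [x] is a sum of homogeneous elements of degrees at least [m]. *)
Definition gr_from (m : nat) (x : A) := exists n (z : nat -> A),
  (forall i, z i \in G (m + i)%N) /\ x = \sum_(i < n) z i.

Lemma gr_from_ind m (P : A -> Prop) : P 0 ->
  (forall x y, P x -> P y -> P (x + y)) ->
  (forall i x, x \in G (m + i)%N -> P x) -> forall x, gr_from m x -> P x.
Proof.
move=> P0 PD Pz x [n [z [zG ->]]]; elim/big_ind: _ => // i _; exact: Pz (zG i).
Qed.

Lemma gr_from0 m : gr_from m 0.
Proof. by exists 0%N, (fun=> 0); rewrite big_ord0; split=> // i; exact: gr_0. Qed.

Lemma gr_from_piece m i x : x \in G (m + i)%N -> gr_from m x.
Proof.
move=> xG; exists i.+1, (fun j => if j == i then x else 0); split=> [j|].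
  by case: eqP => [->|_] //; exact: gr_0.
rewrite (bigD1 ord_max) //= eqxx big1 ?addr0 // => j.
by rewrite -val_eqE /= => /negPf ->.
Qed.

Lemma gr_fromD m x y : gr_from m x -> gr_from m y -> gr_from m (x + y).
Proof.
pose cut n (z : nat -> A) i := if (i < n)%N then z i else 0.
have cutG n z : (forall i, z i \in G (m + i)%N) -> forall i, cut n z i \in G (m + i)%N.
  by move=> zG i; rewrite /cut; case: ifP => // _; exact: gr_0.
have cut_sum n l (z : nat -> A) : (n <= l)%N ->
    \sum_(i < n) z i = \sum_(i < l) cut n z i.
  move=> nl; rewrite (big_ord_widen_cond l (fun=> true) z nl).
  by rewrite [RHS](eq_bigr (fun i : 'I_l => if (i < n)%N then z i else 0)) //
             -big_mkcondr.
move=> [n [z [zG ->]]] [l [w [wG ->]]].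
exists (maxn n l), (fun i => cut n z i + cut l w i); split=> [i|].
  by apply: gr_D; apply: cutG.
by rewrite (cut_sum _ _ _ (leq_maxl n l)) (cut_sum _ _ _ (leq_maxr n l)) big_split.
Qed.

Lemma gr_fromM m l x y : gr_from m x -> gr_from l y -> gr_from (m + l)%N (x * y).
Proof.
move=> Fx.
apply: (@gr_from_ind l (fun y => gr_from (m + l)%N (x * y))) => [|u v Fu Fv|j {}y yG].
- by rewrite mulr0; exact: gr_from0.
- by rewrite mulrDr; exact: gr_fromD.
apply: (gr_from_ind (P := fun x => gr_from (m + l)%N (x * y))) Fx
  => [|u v Fu Fv|i {}x xG].
- by rewrite mul0r; exact: gr_from0.
- by rewrite mulrDl; exact: gr_fromD.
by apply: (@gr_from_piece (m + l) (i + j)); rewrite addnACA; exact: gr_M.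
Qed.

Lemma gr_from_all x : gr_from 0 x.
Proof. by have [n [z [zG ->]]] := gr_span G x; exists n, z. Qed.

Lemma gr_from_split m x : gr_from m x ->
  exists u v, [/\ u \in G m, gr_from m.+1 v & x = u + v].
Proof.
apply: (@gr_from_ind m (fun x => exists u v,
    [/\ u \in G m, gr_from m.+1 v & x = u + v]))
  => [|y z [u [v [uG Fv ->]]] [u' [v' [uG' Fv' ->]]]|[|i] y yG].
- by exists 0, 0; rewrite addr0; split=> //; [exact: gr_0|exact: gr_from0].
- by exists (u + u'), (v + v'); rewrite addrACA; split=> //; [exact: gr_D|exact: gr_fromD].
- by exists y, 0; rewrite addr0 -[m in G m]addn0; split=> //; exact: gr_from0.
- exists 0, y; rewrite add0r; split=> //; first exact: gr_0.
  by apply: (@gr_from_piece _ i); rewrite addSnnS.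
Qed.

Lemma gr_radE x : J x <-> gr_from 1 x.
Proof. by split=> [/asboolP|h]; [|apply/asboolP]. Qed.

Lemma gr_from_disjoint x : x \in G 1 -> gr_from 2 x -> x = 0.
Proof.
move=> xG [n [z [zG xE]]].
pose w j := if j is j'.+2 then z j' else if j is 1 then - x else 0.
have wG j : w j \in G j.
  case: j => [|[|j]] /=; [exact: gr_0|exact: gr_N|exact: (zG j)].
have w0 : \sum_(j < n.+2) w j = 0.
  by rewrite !big_ord_recl /= add0r xE addrC; apply/eqP; rewrite subr_eq0.
have /(_ 1%N isT) /= := gr_free wG w0.
by move/eqP; rewrite oppr_eq0 => /eqP.
Qed.

Lemma gr_rad_mull x a : J x -> J (a * x).
Proof. by move=> /gr_radE Jx; apply/gr_radE; exact: (gr_fromM (gr_from_all a) Jx). Qed.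

Lemma gr_degree0_comm x y : x \in G 0 -> y \in G 0 -> x * y = y * x.
Proof.
have [n [phi [_ _ phiP]]] := gr_degree0 G.
move=> /phiP[u <-] /phiP[v <-]; rewrite -!rmorphM; congr (phi _).
by apply/ffunP => i; rewrite !ffunE mulrC.
Qed.

Lemma gr_one : 1 \in G 0.
Proof.
by have [n [phi [_ _ phiP]]] := gr_degree0 G; apply/phiP; exists 1; rewrite rmorph1.
Qed.

(** Modulo [J] a right ideal is generated by the primitive idempotents of the
    degree 0 part that it contains. *)
Lemma graded_semisimple : semisimple_quotient J.
Proof.
move=> I rI JI; have [n [phi [_ phiI phiP]]] := gr_degree0 G.
pose d i : {ffun 'I_n -> k} := [ffun j => (j == i)%:R].
pose b i := `[< I (phi (d i)) >].
pose c : {ffun 'I_n -> k} := [ffun i => (~~ b i)%:R].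
exists (phi c); split=> [|r Icr].
  have -> : 1 - phi c = \sum_i (if b i then phi (d i) else 0).
    rewrite -(rmorph1 phi) -rmorphB.
    have -> : 1 - c = \sum_i (if b i then d i else 0).
      apply/ffunP => j; rewrite sum_ffunE (bigD1 j) //= big1 => [|i ij].
        by rewrite !ffunE; case: (b j); rewrite ffunE ?eqxx ?subr0 ?subrr ?addr0.
      by case: (b i); rewrite ffunE // eq_sym (negPf ij).
    by rewrite rmorph_sum; apply: eq_bigr => i _; case: (b i); rewrite ?rmorph0.
  apply: (right_ideal_sum rI) => i; case: ifPn => [/asboolP //|_]; exact: (right_ideal0 rI).
have [u [v [/phiP[y <-] /gr_radE Jv rE]]] := gr_from_split (gr_from_all r).
have Jcv : J (phi c * v) by exact: gr_rad_mull.
move: Icr; rewrite rE mulrDr => Icr.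
have := right_idealB rI Icr (JI _ Jcv); rewrite addrK -rmorphM.
move=> Iz; suff cy : c * y = 0 by rewrite cy rmorph0 add0r.
apply/ffunP => i; rewrite [RHS]ffunE; apply: contrapT => /eqP zi.
have ci : ~~ b i by apply: contraNN zi => bi; rewrite !ffunE bi mul0r.
case/asboolP: ci.
have := right_idealM rI (phi [ffun j : 'I_n => ((c * y) i)^-1 * (j == i)%:R]) Iz.
rewrite -rmorphM; congr (I (phi _)); apply/ffunP => j.
rewrite [LHS]ffunE [X in _ * X = _]ffunE [RHS]ffunE.
by have [->|_] := eqVneq j i; rewrite ?mulr0 // mulr1 mulfV.
Qed.

Section Idempotent.
Variables (e : A) (ee : e * e = e) (eG : e \in G 0).

Lemma gr_compl : 1 - e \in G 0.
Proof. by apply: gr_D; [exact: gr_one|exact: gr_N]. Qed.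

Lemma graded_corner a : J (e * a * (1 - e)).
Proof.
have [u [v [uG Fv ->]]] := gr_from_split (gr_from_all a).
rewrite [e * (_ + _)]mulrDr mulrDl -mulrA (gr_degree0_comm uG gr_compl) mulrA.
rewrite mulrBr mulr1 ee subrr mul0r add0r; apply/gr_radE.
have := gr_fromM (gr_fromM (gr_from_all e) Fv) (gr_from_all (1 - e)).
by rewrite add0n addn0.
Qed.

(** The elements of [e A_1 (1 - e)], plus terms of degree at least 2, form a
    right ideal [M] containing [e J (1 - e)] and [e J J]. If it contains [e J],
    then [e A_1] is [e A_1 (1 - e)] and generates [e J]. *)
Lemma graded_nakayama : nakayama_property J e.
Proof.
move=> H T rT Tf.
pose M x := exists u v, [/\ u \in G 1, gr_from 2 v & x = e * u * (1 - e) + v].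
have eufG u : u \in G 1 -> e * u * (1 - e) \in G 1.
  by move=> uG; exact: (gr_M (gr_M eG uG) gr_compl).
have HM x : J x -> M (e * x).
  apply: (H M) => [||x' y' /gr_radE Fx /gr_radE Fy].
  - split=> [|a x1 x2 [u [v [uG Fv ->]]] [u' [v' [uG' Fv' ->]]]].
      by exists 0, 0; rewrite mulr0 mul0r addr0; split=> //; [exact: gr_0|exact: gr_from0].
    have [a0 [a1 [aG Fa aE]]] := gr_from_split (gr_from_all (a : A)).
    exists (u * a0 + u'), (e * u * (1 - e) * a1 + v * a + v'); split.
    + by apply: gr_D => //; have := gr_M uG aG.
    + apply: gr_fromD => //; apply: gr_fromD.
        apply: (@gr_fromM 1 1 _ _ _ Fa); apply: (@gr_from_piece 1 0); exact: eufG.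
      by have := gr_fromM Fv (gr_from_all a).
    rewrite -[a *: _]/((e * u * (1 - e) + v) * (a : A)).
    have -> : e * (u * a0 + u') * (1 - e) = e * u * (1 - e) * a0 + e * u' * (1 - e).
      rewrite [e * (_ + _)]mulrDr mulrDl; congr (_ + _).
      by rewrite -[RHS]mulrA (gr_degree0_comm gr_compl aG) !mulrA.
    have -> : (e * u * (1 - e) + v) * (a : A) =
        e * u * (1 - e) * a0 + (e * u * (1 - e) * a1 + v * (a : A)).
      by rewrite mulrDl {1}aE mulrDr addrA.
    by rewrite -!addrA; congr (_ + _); rewrite [RHS]addrCA; congr (_ + _); rewrite addrCA.
  - move=> x' /gr_radE /gr_from_split[u [v [uG Fv ->]]].
    exists u, (e * v * (1 - e)); split=> //; last by rewrite [e * (_ + _)]mulrDr mulrDl.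
    have := gr_fromM (gr_fromM (gr_from_all e) Fv) (gr_from_all (1 - e)).
    by rewrite add0n addn0.
  exists 0, (e * x' * y'); rewrite mulr0 mul0r add0r; split=> //; first exact: gr_0.
  by rewrite -mulrA; exact: (gr_fromM (gr_from_all e) (gr_fromM Fx Fy)).
move=> x /gr_radE; apply: (gr_from_ind (P := fun x => T (e * x))) => [|y z Ty Tz|i y].
- by rewrite mulr0; exact: (right_ideal0 rT).
- by rewrite mulrDr; exact: (right_idealD rT).
move=> /gr_mul[n [p [q [pG qG ->]]]]; rewrite mulr_sumr.
apply: (right_ideal_sum rT) => // t; rewrite mulrA; apply: (right_idealM rT) => //.
have Jp u : u \in G 1 -> J u by move=> uG; apply/gr_radE/(@gr_from_piece 1 0).
have [u [v [uG Fv epE]]] := HM _ (Jp _ (pG t)).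
rewrite epE (_ : v = 0) ?addr0; first exact/Tf/Jp.
apply: gr_from_disjoint => //.
have -> : v = e * p t - e * u * (1 - e) by rewrite epE addrC addKr.
by apply: gr_D; [exact: (gr_M eG (pG t))|apply/gr_N/eufG].
Qed.

End Idempotent.
End Graded.

(** * The global dimensions *)

Section Setting.
Variables (k : fieldType) (A : algType k) (s : setting A) (e : A).
Notation J := (fun x : A => (x : (A^c)^o) \in radical s).

Lemma radical_mull x a : J x -> J (a * x).
Proof. by case: s => [sA bA|G]; [exact: jacobson_mull|exact: gr_rad_mull]. Qed.

Hypotheses (ee : e * e = e) (noethA : noetherian A) (eG : degree0 s e).

(** [S_e] is the quotient of [A] by the right ideal of the [a] with [e a] in the
    radical. *)
Lemma top_projection : exists pi : {linear (A^c)^o -> top_mod s e},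
  (forall t, exists a, pi a = t) /\ forall a : A, pi a = 0 <-> J (e * a).
Proof.
rewrite /top_mod /subquo; set N := submod_preim _.
have [q [qS qE]] := quomod_projection N.
have inN (a : A) : (e * a : (A^c)^o) \in idem_mul e (@full_ideal A).
  by apply/asboolP; exists a.
have [i iE] : exists i : {linear (A^c)^o -> submod (idem_mul e (@full_ideal A))},
    forall a : A, val (i a) = e * a.
  have iL : linear (fun a : (A^c)^o =>
    exist (fun x => x \in idem_mul e (@full_ideal A)) (e * (a : A)) (inN a)
      : submod (idem_mul e (@full_ideal A))).
    by move=> a x y; apply: val_inj; rewrite /= mulrDr mulrA.
  by have [i iE] := linearW iL; exists i => a; rewrite iE.
exists (q \o i); split=> [t|a].
  have [[x xN] <-] := qS t; have /asboolP[r _ xE] := xN.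
  by exists r => /=; congr (q _); apply: val_inj; rewrite iE -xE.
apply: (iff_trans (qE (i a))).
have -> : (i a \in N) = ((e * a : A) \in idem_mul e (radical s)) by rewrite -iE.
split=> [/asboolP[r rJ ->]|Jea]; first exact: radical_mull.
by apply/asboolP; exists (e * a : A); rewrite // mulrA ee.
Qed.
Lemma radical_semisimple : semisimple_quotient J.
Proof.
by case: s => [sA bA|G]; [exact: semiperfect_semisimple|exact: graded_semisimple].
Qed.

Lemma radical_corner a : J (e * a * (1 - e)).
Proof.
move: eG; case: s => [sA bA|G] /= eG0; first exact: basic_corner.
exact: graded_corner.
Qed.

Lemma radical_nakayama : nakayama_property J e.
Proof.
move: eG; case: s => [sA bA|G] /= eG0; last exact: graded_nakayama.
by apply: semiperfect_nakayama; case: noethA.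
Qed.

Notation S := (top_mod s e).
Notation null := (null_mod (1 - e)).
Hypothesis extS : forall i, (0 < i)%N -> Ext_eq0 S S i.

(** The properties of the modules annihilated by [1 - e] inherited from [S]. *)
Lemma null_top_properties :
  [/\ forall n (W V : lmodType A^c), null W -> null V -> ext n W V,
      forall n W, pdle n S -> null W -> pdle n W
    & forall n M V, ext n M S -> null V -> ext n M V].
Proof.
have [pi [piS piP]] := top_projection; have ss := radical_semisimple.
have J0 : J 0 by exact: (@rpred0 _ (radical s)).
have JD x y : J x -> J y -> J (x + y) by exact: (@rpredD _ (radical s)).
have Jr x a : J x -> J (x * a) by exact: (@rpredZ _ _ (radical s) (a : A^c) x).
have Jl := radical_mull.
have eSS n : ext n S S by apply: Ext_eq0_ext; exact: extS.
have nJ (V : lmodType A^c) : null V -> J_null J V.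
  exact: (null_J_null ss ee Jr Jl piS piP J0 JD radical_nakayama (eSS 0%N)).
split=> [n W V|n W|n M V].
- exact: (null_ext ss Jl radical_corner piS piP nJ).
- exact: (null_pdle ss radical_corner piS piP nJ).
- exact: (null_ext2 ss Jl radical_corner piS piP nJ).
Qed.

Notation Gamma := (corner (idem_compl ee)).

Lemma gldim_ring_bound n :
  (gldim Gamma <= (Posz n)%:E)%E -> (gldim A <= (Posz (n + n.+2)%N)%:E)%E.
Proof.
have [en _ _] := null_top_properties.
by move=> /gldim_leP pG; apply/gldim_leP => M; apply: (pdle_of_corner en pG).
Qed.

(** The hypothesis with [d] says that Ext^i(M, S) = 0 for all [i > d]; it holds
    when [d] is the injective dimension of [S], and also when [d = g]. *)
Lemma gldim_corner_bound g p d :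
  (gldim A <= (Posz g)%:E)%E -> (pd S <= (Posz p)%:E)%E -> (d <= g)%N ->
  (forall i M, (d <= i)%N -> ext i M S) ->
  (gldim Gamma <= (Posz (maxn g (d + p.-1)%N))%:E)%E.
Proof.
have [en pn e2n] := null_top_properties.
move=> /gldim_leP pA /pd_leP pS dg dS; apply/gldim_leP => X.
have [M [a [b ba]]] := cmod_ess_surj X; apply: (pdle_retract ba).
apply: (pdle_corner en (p := p)) (pA M) dg => [W W0|i V di V0]; first exact: pn.
by apply: e2n => //; exact: dS.
Qed.

End Setting.

Lemma least_cases (P : nat -> Prop) :
  least P = +oo%E \/ exists n, least P = (Posz n)%:E.
Proof.
rewrite /least; case: pselect => [exP|_]; [right|by left].
by case: ex_minnP => m _ _; exists m.
Qed.

Local Open Scope ereal_scope.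

Theorem mainTheorem1 (k : closedFieldType) (A : algType k) (s : setting A)
    (e : A) (ee : (e * e)%R = e) :
  noetherian A -> e != 0%R -> degree0 s e ->
  let Gamma := corner (idem_compl ee) in
  let S := top_mod s e in
  (forall i, (0 < i)%N -> Ext_eq0 S S i) ->
  [/\ gldim A < +oo <-> gldim Gamma < +oo,
      gldim Gamma <= maxe (inj_dim S + pd S - 1) (gldim A)
    & gldim A <= 2%:E * gldim Gamma + 2%:E].
Proof.
move=> noethA _ eG Gamma S extS.
have ring_bound := gldim_ring_bound (ee := ee) noethA eG extS.
have corner_bound := gldim_corner_bound ee noethA eG extS.
have pdS g : gldim A <= (Posz g)%:E -> pd S <= (Posz g)%:E.
  by move=> /gldim_leP pA; apply/pd_leP.
have extA g : gldim A <= (Posz g)%:E -> forall i M, (g <= i)%N -> ext i M S.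
  by move=> /gldim_leP pA i M gi; exact: (pdle_leq gi (pA M)).
split.
- have [gA|[g gA]] : gldim A = +oo \/ exists g, gldim A = (Posz g)%:E := least_cases _.
    rewrite gA ltxx; split=> // gG.
    have [gE|[n gE]] : gldim Gamma = +oo \/ exists n, gldim Gamma = (Posz n)%:E :=
      least_cases _; first by rewrite gE ltxx in gG.
    have := ring_bound n; rewrite -/Gamma gE lexx gA => /(_ isT).
    by rewrite leye_eq.
  rewrite gA ltry; split=> // _.
  have gA' : gldim A <= (Posz g)%:E by rewrite gA.
  apply: le_lt_trans (ltry _).
  exact: (corner_bound g g g gA' (pdS g gA') (leqnn g) (extA g gA')).
- have [gA|[g gA]] : gldim A = +oo \/ exists g, gldim A = (Posz g)%:E := least_cases _.
    by rewrite gA maxey leey.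
  have gA' : gldim A <= (Posz g)%:E by rewrite gA.
  have [pE|[p pE]] : pd S = +oo \/ exists p, pd S = (Posz p)%:E := least_cases _.
    by have := pdS g gA'; rewrite pE leye_eq.
  have [iE|[d iE]] : inj_dim S = +oo \/ exists d, inj_dim S = (Posz d)%:E :=
    least_cases _.
    by rewrite iE pE /= maxye leey.
  have pE' : pd S <= (Posz p)%:E by rewrite pE.
  (* As [d] may exceed [g], the smaller of the two is used. *)
  have eS i M : (minn d g <= i)%N -> ext i M S.
    rewrite geq_min => /orP[di|gi]; last exact: extA gA' _ _ gi.
    by apply: inj_dim_ext; rewrite iE lee_fin lez_nat.
  apply: le_trans (corner_bound g p (minn d g) gA' pE' (geq_minr d g) eS) _.
  rewrite iE pE gA -EFin_max lee_fin.
  have [le|gt] := leqP (minn d g + p.-1)%N g; first by rewrite le_max lexx orbT.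
  case: p gt {pE pE'} => [|p] gt; first by rewrite addn0 ltnNge geq_minr in gt.
  have -> : (Posz d + Posz p.+1 - 1 = Posz (d + p))%R.
    by rewrite -addn1 !PoszD addrA addrK.
  by rewrite le_max lez_nat leq_add2r geq_minl.
have [gE|[n gE]] : gldim Gamma = +oo \/ exists n, gldim Gamma = (Posz n)%:E :=
    least_cases _.
  by rewrite gE gt0_muley ?addye ?leey // lte_fin.
have := ring_bound n; rewrite -/Gamma gE lexx => /(_ isT) /le_trans; apply.
rewrite -EFinM -EFinD lee_fin addnS addnS -addn2 addnn -mul2n PoszD PoszM.
by [].
Qed.
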